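(* Let $n\ge 1$ and let $\mathbb H^n$ be the $n$-dimensional real hyperbolic space with its hyperbolic distance. There exist a locally compact median space $\mathcal M$, an action of $\mathrm{Isom}(\mathbb H^n)$ on $\mathcal M$ by isometries, and an $\mathrm{Isom}(\mathbb H^n)$-equivariant isometric embedding $\varphi:\mathbb H^n\to\mathcal M$ such that $\mathcal M$ is at finite Hausdorff distance from $\varphi(\mathbb H^n)$.
   Context: A median space is a metric space $(\mathcal M,d)$ such that for every triple of points $x_1,x_2,x_3$ there is a unique point $m$ with $d(x_i,m)+d(m,x_j)=d(x_i,x_j)$ for all $i\ne j$ in $\{1,2,3\}$. An isometric embedding is a distance-preserving map. *)

(* Defs.v *)
From HB Require Import structures.
From mathcomp Require Import all_boot all_order all_algebra.
From mathcomp Require Import all_classical all_reals all_analysis.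
From mathcomp Require Import ring lra.

Set Implicit Arguments.
Unset Strict Implicit.
Unset Printing Implicit Defensive.

Import Order.TTheory GRing.Theory Num.Theory.

Local Open Scope classical_set_scope.
Local Open Scope ring_scope.

Definition isometric (R : realType) (X Y : metricType R) (f : X -> Y) : Prop :=
  forall x y, mdist (f x) (f y) = mdist x y.

(** The group of bijective isometries of a metric space, with composition
    as product: [(g * h)%g x = g (h x)]. *)

Definition is_isom (R : realType) (X : metricType R) : pred (X -> X) :=
  fun g => `[< isometric g /\ bijective g >].

Record isom (R : realType) (X : metricType R) := Isom {
  isom_fun :> X -> X;
  isomP : is_isom isom_fun }.

Arguments isom {R} X.

HB.instance Definition _ (R : realType) (X : metricType R) :=
  [isSub for @isom_fun R X].
HB.instance Definition _ (R : realType) (X : metricType R) :=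
  [Choice of isom X by <:].

Section IsomGroup.
Context {R : realType} {X : metricType R}.
Implicit Types g h : isom X.

Lemma isom_isometric g : isometric g.
Proof. by have /asboolP[] := isomP g. Qed.

Lemma isom_bij g : bijective g.
Proof. by have /asboolP[] := isomP g. Qed.

Lemma isom_ext g h : g =1 h -> g = h.
Proof. by move=> gh; apply: val_inj; apply: funext. Qed.

Lemma id_isom_subproof : is_isom (@id X).
Proof. by apply/asboolP; split => //; exists id. Qed.

Definition isom_id : isom X := Isom id_isom_subproof.

Lemma comp_isom_subproof g h : is_isom (g \o h).
Proof.
apply/asboolP; split; first by move=> x y /=; rewrite !isom_isometric.
exact: bij_comp (isom_bij g) (isom_bij h).
Qed.

Definition isom_comp g h : isom X := Isom (comp_isom_subproof g h).

Lemma isom_inv_subproof g :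
  exists h : isom X, cancel g h /\ cancel h g.
Proof.
have [f gf fg] := isom_bij g.
have fP : is_isom f.
  apply/asboolP; split; last by exists g.
  by move=> x y; rewrite -(isom_isometric g) !fg.
by exists (Isom fP).
Qed.

Definition isom_inv g : isom X := sval (cid (isom_inv_subproof g)).

Lemma isom_invK g : cancel g (isom_inv g) /\ cancel (isom_inv g) g.
Proof. by rewrite /isom_inv; case: cid. Qed.

Let isom_compA : associative isom_comp.
Proof. by move=> f g h; apply: isom_ext. Qed.

Let isom_comp1g : left_id isom_id isom_comp.
Proof. by move=> g; apply: isom_ext. Qed.

Let isom_compg1 : right_id isom_id isom_comp.
Proof. by move=> g; apply: isom_ext. Qed.

Let isom_compVg : left_inverse isom_id isom_inv isom_comp.
Proof. by move=> g; apply: isom_ext => x /=; have [-> _] := isom_invK g. Qed.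

Let isom_compgV : right_inverse isom_id isom_inv isom_comp.
Proof. by move=> g; apply: isom_ext => x /=; have [_ ->] := isom_invK g. Qed.

HB.instance Definition _ := isGroup.Build (isom X)
  isom_compA isom_comp1g isom_compg1 isom_compVg isom_compgV.

End IsomGroup.

Lemma isom1E (R : realType) (X : metricType R) (x : X) : (1%g : isom X) x = x.
Proof. by []. Qed.

Lemma isomME (R : realType) (X : metricType R) (g h : isom X) (x : X) :
  (g * h)%g x = g (h x).
Proof. by []. Qed.

Definition isometric_action (R : realType) (G : groupType) (X : metricType R)
    (act : G -> X -> X) : Prop :=
  [/\ forall x, act 1%g x = x,
      forall g h x, act (g * h)%g x = act g (act h x)
    & forall g, isometric (act g)].

Definition median_space (R : realType) (M : metricType R) : Prop :=
  forall x : 'I_3 -> M, exists! m : M, forall i j : 'I_3, i != j ->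
    mdist (x i) m + mdist m (x j) = mdist (x i) (x j).

Definition hausdorff_dist (R : realType) (X : metricType R) (A B : set X) :
    \bar R :=
  ereal_inf [set r%:E | r in [set r : R |
    [/\ 0 < r, A `<=` \bigcup_(b in B) ball b r
             & B `<=` \bigcup_(a in A) ball a r]]].

(** The hyperboloid model of the [n]-dimensional real hyperbolic space: the
    upper sheet of [<x, x> = -1] in [R^(n+1)], where [<x, y>] is the Minkowski
    form below and [cosh (d x y) = - <x, y>]. *)

Definition minkowski (R : realType) (n : nat) (x y : 'rV[R]_n.+1) : R :=
  \sum_(i < n) x 0 (lift ord0 i) * y 0 (lift ord0 i) - x 0 ord0 * y 0 ord0.

Definition arcosh (R : realType) (t : R) : R := ln (t + Num.sqrt (t ^+ 2 - 1)).

Definition on_hyperboloid (R : realType) (n : nat) : pred 'rV[R]_n.+1 :=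
  fun x => (minkowski x x == -1) && (0 < x 0 ord0).

Record hyperbolic (R : realType) (n : nat) := Hyperbolic {
  hyp_val :> 'rV[R]_n.+1;
  hypP : on_hyperboloid hyp_val }.

HB.instance Definition _ (R : realType) (n : nat) :=
  [isSub for @hyp_val R n].
HB.instance Definition _ (R : realType) (n : nat) :=
  [Choice of hyperbolic R n by <:].

Definition hyp_dist (R : realType) (n : nat) (x y : hyperbolic R n) : R :=
  arcosh (- minkowski x y).

Section HyperbolicMetric.
Context {R : realType} {n : nat}.
Local Notation V := 'rV[R]_n.+1.
Implicit Types (x y z u v : V) (a b c : R).

Lemma minkowskiC x y : minkowski x y = minkowski y x.
Proof.
by rewrite /minkowski mulrC; congr (_ - _); apply: eq_bigr => i _; rewrite mulrC.
Qed.

Lemma minkowskiDZl a x y z :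
  minkowski (a *: x + y) z = a * minkowski x z + minkowski y z.
Proof.
rewrite /minkowski !mxE mulrBr mulr_sumr.
under eq_bigr => i _ do rewrite !mxE mulrDl -mulrA.
by rewrite big_split /=; ring.
Qed.

Lemma minkowskiDZr a x y z :
  minkowski z (a *: x + y) = a * minkowski z x + minkowski z y.
Proof. by rewrite minkowskiC minkowskiDZl !(minkowskiC z). Qed.

Lemma minkowski0l z : minkowski 0 z = 0.
Proof.
by rewrite /minkowski mxE mul0r big1 ?subr0// => i _; rewrite mxE mul0r.
Qed.

Lemma minkowskiZl a x z : minkowski (a *: x) z = a * minkowski x z.
Proof. by rewrite -[a *: x]addr0 minkowskiDZl minkowski0l addr0. Qed.

Lemma sum_CauchySchwarz (f g : 'I_n -> R) :
  (\sum_i f i * g i) ^+ 2 <= (\sum_i f i ^+ 2) * (\sum_i g i ^+ 2).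
Proof.
set B := \sum_i f i * g i; set A := \sum_i f i ^+ 2; set C := \sum_i g i ^+ 2.
have A0 : 0 <= A by apply: sumr_ge0 => i _; exact: sqr_ge0.
have key a b : 0 <= a ^+ 2 * A + 2 * (a * b) * B + b ^+ 2 * C.
  have -> : a ^+ 2 * A + 2 * (a * b) * B + b ^+ 2 * C =
      \sum_i (a * f i + b * g i) ^+ 2.
    rewrite /A /B /C !mulr_sumr -!big_split /=.
    by apply: eq_bigr => i _; ring.
  by apply: sumr_ge0 => i _; exact: sqr_ge0.
have [A00|/eqP An0] := eqVneq A 0.
  have f0 i : f i = 0.
    have /eqP := A00; rewrite psumr_eq0; last by move=> j _; exact: sqr_ge0.
    by move/allP/(_ i); rewrite mem_index_enum sqrf_eq0 => /(_ isT)/eqP.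
  have -> : B = 0 by apply: big1 => i _; rewrite f0 mul0r.
  by rewrite A00 mul0r expr0n.
have Apos : 0 < A by rewrite lt_neqAle A0 andbT eq_sym; apply/eqP.
have := key (- B) A.
have -> : (- B) ^+ 2 * A + 2 * (- B * A) * B + A ^+ 2 * C =
  A * (A * C - B ^+ 2) by ring.
by rewrite pmulr_rge0// subr_ge0.
Qed.

Lemma minkowskixx x :
  minkowski x x = \sum_(i < n) x 0 (lift ord0 i) ^+ 2 - x 0 ord0 ^+ 2.
Proof. by rewrite /minkowski expr2; under eq_bigr do rewrite -expr2. Qed.

Lemma minkowski_orth_ge0 y u : minkowski y y = -1 -> minkowski u y = 0 ->
  0 <= minkowski u u /\ (minkowski u u = 0 -> u = 0).
Proof.
rewrite !minkowskixx => yy; rewrite /minkowski => /eqP; rewrite subr_eq0 => /eqP uy.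
have := sum_CauchySchwarz (fun i => u 0 (lift ord0 i)) (fun i => y 0 (lift ord0 i)).
rewrite /= uy.
move: yy; set Y := \sum_(i < n) _; set U := \sum_(i < n) _ => yy.
have U0 : 0 <= U by apply: sumr_ge0 => i _; exact: sqr_ge0.
have Y0 : 0 <= Y by apply: sumr_ge0 => i _; exact: sqr_ge0.
have y2 : y 0 ord0 ^+ 2 = Y + 1 by lra.
rewrite exprMn y2 => h; split; first by nra.
move=> UU; have U00 : U = 0 by nra.
apply/rowP => i; rewrite mxE; case: (unliftP ord0 i) => [j ->|->].
  have /eqP := U00; rewrite psumr_eq0; last by move=> k _; exact: sqr_ge0.
  by move/allP/(_ j); rewrite mem_index_enum sqrf_eq0 => /(_ isT)/eqP.
by apply/eqP; rewrite -sqrf_eq0; apply/eqP; lra.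
Qed.

Lemma minkowski_orth_CS y u v : minkowski y y = -1 ->
  minkowski u y = 0 -> minkowski v y = 0 ->
  minkowski u v ^+ 2 <= minkowski u u * minkowski v v.
Proof.
move=> yy uy vy.
have [uu0 uu] := minkowski_orth_ge0 yy uy.
have [vv0 _] := minkowski_orth_ge0 yy vy.
have key a b : 0 <= a ^+ 2 * minkowski u u + 2 * (a * b) * minkowski u v
    + b ^+ 2 * minkowski v v.
  have w0 : minkowski (a *: u + b *: v) y = 0.
    by rewrite minkowskiDZl minkowskiZl uy vy !mulr0 addr0.
  have [+ _] := minkowski_orth_ge0 yy w0.
  rewrite !minkowskiDZl !minkowskiDZr !minkowskiZl.
  rewrite !(minkowskiC _ (b *: v)) !minkowskiZl.
  by rewrite (minkowskiC v u); congr (0 <= _); ring.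
have [uu00|/eqP un0] := eqVneq (minkowski u u) 0.
  have -> : minkowski u v = 0.
    by rewrite (uu uu00) minkowski0l.
  by rewrite uu00 mul0r expr0n.
have up : 0 < minkowski u u by rewrite lt_neqAle uu0 andbT eq_sym; apply/eqP.
have := key (- minkowski u v) (minkowski u u).
have -> : (- minkowski u v) ^+ 2 * minkowski u u +
  2 * (- minkowski u v * minkowski u u) * minkowski u v +
  minkowski u u ^+ 2 * minkowski v v =
  minkowski u u * (minkowski u u * minkowski v v - minkowski u v ^+ 2) by ring.
by rewrite pmulr_rge0// subr_ge0.
Qed.

Lemma hyp_mink (p : hyperbolic R n) : minkowski p p = -1.
Proof. by have /andP[/eqP] := hypP p. Qed.

Lemma hyp_gt0 (p : hyperbolic R n) : 0 < (p : V) 0 ord0.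
Proof. by have /andP[] := hypP p. Qed.

Lemma hyp_ge1 (p q : hyperbolic R n) : 1 <= - minkowski p q.
Proof.
have := hyp_mink p; have := hyp_mink q; rewrite !minkowskixx /minkowski.
have := sum_CauchySchwarz (fun i => (p : V) 0 (lift ord0 i))
  (fun i => (q : V) 0 (lift ord0 i)).
have := hyp_gt0 p; have := hyp_gt0 q.
rewrite /=.
set P := \sum_(i < n) (p : V) 0 (lift ord0 i) ^+ 2.
set Q := \sum_(i < n) (q : V) 0 (lift ord0 i) ^+ 2.
set S := \sum_(i < n) (p : V) 0 (lift ord0 i) * (q : V) 0 (lift ord0 i).
have P0 : 0 <= P by apply: sumr_ge0 => i _; exact: sqr_ge0.
have Q0 : 0 <= Q by apply: sumr_ge0 => i _; exact: sqr_ge0.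
set a := hyp_val p 0 ord0; set b := hyp_val q 0 ord0 => b0 a0 PQ qq pp.
have a2 : P = a ^+ 2 - 1 by lra.
have b2 : Q = b ^+ 2 - 1 by lra.
have a1 : 1 <= a by rewrite -(@ler_pXn2r _ 2) ?nnegrE ?expr1n//; lra.
have b1 : 1 <= b by rewrite -(@ler_pXn2r _ 2) ?nnegrE ?expr1n//; lra.
have ab : 0 <= a * b - 1 by nra.
have le : S ^+ 2 <= (a * b - 1) ^+ 2.
  apply: (le_trans PQ); rewrite a2 b2 -subr_ge0.
  rewrite (_ : _ - _ = (a - b) ^+ 2); last by ring.
  exact: sqr_ge0.
have : `|S| <= a * b - 1.
  by rewrite -(@ler_pXn2r _ 2) ?nnegrE// real_normK// num_real.
by move=> /(le_trans (ler_norm S)); lra.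
Qed.

Lemma arcosh_arg_ge1 (t : R) : 1 <= t -> 1 <= t + Num.sqrt (t ^+ 2 - 1).
Proof. by move=> t1; have := sqrtr_ge0 (t ^+ 2 - 1); lra. Qed.

Lemma hyp_triangle_cosh (p q r : hyperbolic R n) :
  - minkowski p r <= - minkowski p q * - minkowski q r +
    Num.sqrt ((- minkowski p q) ^+ 2 - 1) *
    Num.sqrt ((- minkowski q r) ^+ 2 - 1).
Proof.
set a := - minkowski p q; set b := - minkowski q r.
have a1 : 1 <= a := hyp_ge1 p q; have b1 : 1 <= b := hyp_ge1 q r.
have pp := hyp_mink p; have qq := hyp_mink q; have rr := hyp_mink r.
have rq : minkowski r q = - b by rewrite minkowskiC /b opprK.
have pq : minkowski p q = - a by rewrite /a opprK.
have qr : minkowski q r = - b by rewrite /b opprK.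
have qp : minkowski q p = - a by rewrite minkowskiC.
pose u : V := - a *: (q : V) + p; pose v : V := - b *: (q : V) + r.
have uq : minkowski u q = 0 by rewrite minkowskiDZl qq pq; ring.
have vq : minkowski v q = 0 by rewrite minkowskiDZl qq rq; ring.
have := minkowski_orth_CS qq uq vq.
rewrite !minkowskiDZl !minkowskiDZr qq pp rr pq rq qr qp => h.
have a20 : 0 <= a ^+ 2 - 1 by nra.
rewrite -sqrtrM// -lerBlDl; apply: (le_trans (ler_norm _)).
rewrite -sqrtr_sqr ler_wsqrtr//.
by move: h; set c := minkowski p r; lra.
Qed.

Let hyp_distxx (p : hyperbolic R n) : hyp_dist p p = 0.
Proof.
by rewrite /hyp_dist hyp_mink opprK /arcosh expr1n subrr sqrtr0 addr0 ln1.
Qed.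

Let hyp_dist_positivity (p q : hyperbolic R n) : hyp_dist p q = 0 -> p = q.
Proof.
rewrite /hyp_dist /arcosh; have := hyp_ge1 p q.
set t := - minkowski p q => t1 /eqP.
rewrite ln_eq0 ?(lt_le_trans _ (arcosh_arg_ge1 t1))// => /eqP te.
have tE : t = 1 by have := sqrtr_ge0 (t ^+ 2 - 1); lra.
pose u : V := - 1 *: (q : V) + p.
have qq := hyp_mink q; have pp := hyp_mink p.
have pq : minkowski p q = -1 by move: tE; rewrite /t => <-; rewrite opprK.
have uq : minkowski u q = 0 by rewrite minkowskiDZl qq pq; ring.
have [_ h] := minkowski_orth_ge0 qq uq.
apply: val_inj => /=; apply/eqP; rewrite -subr_eq0 addrC -scaleN1r; apply/eqP.
by apply: h; rewrite !minkowskiDZl !minkowskiDZr qq pp pq minkowskiC pq; ring.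
Qed.

Let hyp_dist_sym (p q : hyperbolic R n) : hyp_dist p q = hyp_dist q p.
Proof. by rewrite /hyp_dist minkowskiC. Qed.

Let hyp_dist_triangle (q p r : hyperbolic R n) :
  hyp_dist p r <= hyp_dist p q + hyp_dist q r.
Proof.
have := hyp_triangle_cosh p q r; rewrite /hyp_dist /arcosh /=.
have := hyp_ge1 p q; have := hyp_ge1 q r; have := hyp_ge1 p r.
set a := - minkowski p q; set b := - minkowski q r; set c := - minkowski p r.
move=> c1 b1 a1 h.
have a20 : 0 <= a ^+ 2 - 1 by nra.
have b20 : 0 <= b ^+ 2 - 1 by nra.
have sa := sqr_sqrtr a20; have sb := sqr_sqrtr b20.
have ga := arcosh_arg_ge1 a1; have gb := arcosh_arg_ge1 b1.
have gc := arcosh_arg_ge1 c1.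
rewrite -lnM ?posrE ?(lt_le_trans ltr01)//.
rewrite ler_ln ?posrE ?mulr_gt0 ?(lt_le_trans ltr01)//.
have sa0 := sqrtr_ge0 (a ^+ 2 - 1); have sb0 := sqrtr_ge0 (b ^+ 2 - 1).
move: sa sb sa0 sb0 h {ga gb gc}.
set s := Num.sqrt (a ^+ 2 - 1); set t := Num.sqrt (b ^+ 2 - 1).
move=> sa sb sa0 sb0 h.
suff : Num.sqrt (c ^+ 2 - 1) <= a * t + b * s by nra.
have pos : 0 <= a * t + b * s by rewrite addr_ge0// mulr_ge0//; lra.
rewrite -(@ler_pXn2r _ 2) ?nnegrE ?sqrtr_ge0// sqr_sqrtr; last by nra.
have -> : (a * t + b * s) ^+ 2 = (a * b + s * t) ^+ 2 - 1.
  have : (a * t + b * s) ^+ 2 - (a * b + s * t) ^+ 2 =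
    a ^+ 2 * t ^+ 2 + b ^+ 2 * s ^+ 2 - a ^+ 2 * b ^+ 2 - s ^+ 2 * t ^+ 2 by ring.
  have -> : a ^+ 2 * t ^+ 2 + b ^+ 2 * s ^+ 2 - a ^+ 2 * b ^+ 2 - s ^+ 2 * t ^+ 2
     = -1 by rewrite sa sb; ring.
  lra.
by rewrite lerD2r ler_pXn2r// nnegrE; nra.
Qed.

HB.instance Definition _ := isMetric.Build R (hyperbolic R n)
  hyp_distxx hyp_dist_positivity hyp_dist_sym hyp_dist_triangle.

End HyperbolicMetric.

Lemma hyp_mdistE (R : realType) (n : nat) (x y : hyperbolic R n) :
  mdist x y = arcosh (- minkowski x y).
Proof. by []. Qed.

(* Main.v *)
From HB Require Import structures.
From mathcomp Require Import all_boot all_order all_algebra.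
From mathcomp Require Import all_classical all_reals all_analysis.
From mathcomp Require Import measurable_realfun.
From mathcomp Require Import ring lra.
Require Import Defs.

(** A hyperplane of hyperbolic space is the orthogonal, for the Minkowski form Q,
    of a spacelike vector w of R^(n+1), and the half-space that it bounds is
    { x | <x, w> > 0 }.  The space of half-spaces is thus the cone Q(w) > 0 up to
    positive scaling.  Lebesgue measure on the slice 0 < Q(w) < 1 induces a
    measure on it, which is invariant under isometries because a Lorentz
    transformation has determinant 1 or -1.  A point x is recorded by the set of
    half-spaces that contain it.

    Write w = (t, a), with t the time coordinate and a in R^n.  The half-space
    of w contains x when t < F_x(a), where F_x is the linear form given by the
    projective (Klein) coordinates of x.  The median space M is obtained by
    keeping what survives when medians are taken pointwise: the functions F on
    R^n which are homogeneous for all real scalars, 1-Lipschitz, and of slope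
    bounded away from 1.  The 1-Lipschitz condition says that the half-spaces
    (t, a) with t < F(a) meet pairwise.  The distance between F and G is the measure
    of the half-spaces that they decide differently, divided by a constant.

    - Median: volumes add up along G exactly when G lies pointwise between F
      and H ([volume_between_additive], [volume_between_eq_between]), so that
      pointwise medians of real numbers are the medians of M.
    - Isometric embedding: volumes between points of a geodesic add up, and
      depend only on the hyperbolic distance of the points, because reflections
      act transitively on pairs at a given distance ([lorentz_matching]).  A
      nonnegative additive function is linear, hence [crofton_formula].
    - Action: every isometry is linear, a product of reflections
      ([isom_lorentz]); reflections preserve the measure
      ([measure_preserving_reflection]) and carry spacelike graphs to spacelike
      graphs ([acausal_pull]).
    - Hausdorff distance: given F, let u be a unit vector at which F nearly
      reaches its maximal slope.  The point with Klein coordinates F(u) u is at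
      bounded distance from every hyperplane of the graph of F, since the
      half-spaces below F meet pairwise ([acausal_bounded_position]).  After
      moving that point to the origin, F has slope bounded by a universal constant
      smaller than 1, and the volume between F and the origin is bounded.
    - Local compactness: functions with a given slope bound form an
      equicontinuous family, compact for pointwise convergence, which on this
      family controls volumes ([compact_acausal_with]); a small ball of M has
      such a bound, because exceeding it costs a definite volume
      ([acausal_ball_bounded]). *)

Set Implicit Arguments.
Unset Strict Implicit.
Unset Printing Implicit Defensive.

Import Order.TTheory GRing.Theory Num.Theory.
Import numFieldNormedType.Exports.

Local Open Scope classical_set_scope.
Local Open Scope ring_scope.

(** * Coordinates and Lebesgue measure on row vectors *)

Section Coordinates.
Context {R : realType}.
Implicit Types (n : nat) (t s : R).

Definition rV_cons n t (a : 'rV[R]_n) : 'rV[R]_n.+1 :=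
  \row_i oapp (a 0) t (unlift ord0 i).

Definition rV_head n (w : 'rV[R]_n.+1) : R := w 0 ord0.

Definition rV_tail n (w : 'rV[R]_n.+1) : 'rV[R]_n :=
  \row_j w 0 (lift ord0 j).

Lemma rV_cons0 n t (a : 'rV[R]_n) : rV_head (rV_cons t a) = t.
Proof. by rewrite /rV_head mxE unlift_none. Qed.

Lemma rV_consS n t (a : 'rV[R]_n) i : rV_cons t a 0 (lift ord0 i) = a 0 i.
Proof. by rewrite mxE liftK. Qed.

Lemma rV_consK n t (a : 'rV[R]_n) : rV_tail (rV_cons t a) = a.
Proof. by apply/rowP => j; rewrite mxE rV_consS. Qed.

Lemma rV_eta n (w : 'rV[R]_n.+1) : rV_cons (rV_head w) (rV_tail w) = w.
Proof.
apply/rowP => i; case: (unliftP ord0 i) => [j|] ->; last by rewrite -/(rV_head _) rV_cons0.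
by rewrite rV_consS mxE.
Qed.

Lemma rV_consD n t s (a b : 'rV[R]_n) :
  rV_cons t a + rV_cons s b = rV_cons (t + s) (a + b).
Proof.
apply/rowP => i; case: (unliftP ord0 i) => [j|] ->.
  by rewrite mxE !rV_consS mxE.
by rewrite mxE -!/(rV_head _) !rV_cons0.
Qed.

Lemma rV_consZ n t s (a : 'rV[R]_n) :
  s *: rV_cons t a = rV_cons (s * t) (s *: a).
Proof.
apply/rowP => i; case: (unliftP ord0 i) => [j|] ->.
  by rewrite mxE !rV_consS mxE.
by rewrite mxE -!/(rV_head _) !rV_cons0.
Qed.

End Coordinates.

Section MeasurableRow.
Context {R : realType}.

Definition rV_cylinders n : set (set 'rV[R]_n) :=
  [set A | exists i : 'I_n, exists2 B : set (measurableTypeR R), measurable B &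
    A = [set x : 'rV[R]_n | B (x 0 i)]].

Definition rV_measurable n : set (set 'rV[R]_n) := <<s @rV_cylinders n >>.

Let rV_set0 n : @rV_measurable n set0.
Proof. exact: (@sigma_algebra0 _ setT). Qed.
Let rV_setC n A : @rV_measurable n A -> @rV_measurable n (~` A).
Proof. by move=> mA; rewrite -setTD; exact: sigma_algebraCD. Qed.
Let rV_bigcup n (F : (set 'rV[R]_n)^nat) :
  (forall i, rV_measurable (F i)) -> rV_measurable (\bigcup_i F i).
Proof. exact: (@sigma_algebra_bigcup _ setT). Qed.

HB.instance Definition _ n := @isMeasurable.Build default_measure_display
  'rV[R]_n (@rV_measurable n) (@rV_set0 n) (@rV_setC n) (@rV_bigcup n).

Lemma measurable_coord n (i : 'I_n) :
  measurable_fun [set: 'rV[R]_n] (fun x => x 0 i : measurableTypeR R).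
Proof.
move=> _ B mB; rewrite setTI.
by apply: (@sub_sigma_algebra _ setT (@rV_cylinders n)); exists i; exists B.
Qed.

Lemma measurable_fun_rV d (T : measurableType d) n (f : T -> 'rV[R]_n) :
  (forall i, measurable_fun [set: T] (fun x => f x 0 i : measurableTypeR R)) ->
  measurable_fun [set: T] f.
Proof.
move=> mf; apply: (measurability (@rV_cylinders n)) => //.
move=> _ [_ [i [B mB ->]] <-]; exact: (mf i).
Qed.

Lemma measurable_rV_cons n : measurable_fun [set: measurableTypeR R * 'rV[R]_n]
  (fun p => rV_cons p.1 p.2).
Proof.
apply: measurable_fun_rV => i; case: (unliftP ord0 i) => [j|] ->.
  under eq_fun do rewrite rV_consS.
  exact: (measurableT_comp (measurable_coord j)).
under eq_fun do rewrite -/(rV_head _) rV_cons0.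
exact: measurable_fst.
Qed.

Lemma measurable_rV_tail n : measurable_fun [set: 'rV[R]_n.+1] (@rV_tail R n).
Proof.
apply: measurable_fun_rV => i; under eq_fun do rewrite mxE.
exact: measurable_coord.
Qed.

Lemma measurable_rV_uncons n : measurable_fun [set: 'rV[R]_n.+1]
  (fun w => (rV_head w : measurableTypeR R, rV_tail w)).
Proof.
apply: measurable_fun_pair; first exact: measurable_coord.
exact: measurable_rV_tail.
Qed.

End MeasurableRow.

Section LebesgueRow.
Context {R : realType}.
Local Open Scope ereal_scope.

Section Step.
Variables (n : nat) (mu : {sigma_finite_measure set 'rV[R]_n -> \bar R}).

(** The product measure splits off the first coordinate, which will be the time
    coordinate of Minkowski space. *)
Definition rV_product (A : set 'rV[R]_n.+1) : \bar R :=
  (lebesgue_measure \x mu) [set p | A (rV_cons p.1 p.2)].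

Let mpre (A : set 'rV[R]_n.+1) : measurable A ->
  measurable [set p : measurableTypeR R * 'rV[R]_n | A (rV_cons p.1 p.2)].
Proof. by move=> mA; rewrite -[X in measurable X]setTI; exact: measurable_rV_cons. Qed.

Let rV_product0 : rV_product set0 = 0.
Proof. exact: (measure0 (lebesgue_measure \x mu)). Qed.

Let rV_product_ge0 A : 0 <= rV_product A.
Proof. exact: (measure_ge0 (lebesgue_measure \x mu)). Qed.

Let rV_product_sigma_additive : semi_sigma_additive rV_product.
Proof.
move=> F mF tF mUF; pose cons_pair (p : measurableTypeR R * 'rV[R]_n) := rV_cons p.1 p.2.
have UE : [set p : measurableTypeR R * 'rV[R]_n |
    (\bigcup_k F k) (rV_cons p.1 p.2)] = \bigcup_k (cons_pair @^-1` F k).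
  exact: preimage_bigcup.
rewrite /rV_product UE.
apply: (@measure_semi_sigma_additive _ _ _ (lebesgue_measure \x mu)
  (fun k => cons_pair @^-1` F k)).
- by move=> k; exact: mpre.
- apply/trivIsetP => i j _ _ ij; rewrite -preimage_setI.
  by move/trivIsetP : tF => /(_ _ _ Logic.I Logic.I ij) ->; rewrite preimage_set0.
- by rewrite -UE; exact: mpre.
Qed.

HB.instance Definition _ := isMeasure.Build _ _ _ rV_product
  rV_product0 rV_product_ge0 rV_product_sigma_additive.

Let rV_product_sigma_finite : sigma_finite setT rV_product.
Proof.
have /sigma_finiteP[F [FT ndF Foo]] := sigma_finiteT (@lebesgue_measure R).
have /sigma_finiteP[G [GT ndG Goo]] := sigma_finiteT mu.
have split_rect k : [set p : measurableTypeR R * 'rV[R]_n |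
    [set w | F k (rV_head w) /\ G k (rV_tail w)] (rV_cons p.1 p.2)] = F k `*` G k.
  by apply/seteqP; split=> -[t a]/=; rewrite rV_cons0 rV_consK.
exists (fun k => [set w | F k (rV_head w) /\ G k (rV_tail w)]).
  apply/seteqP; split=> // w _.
  have : [set: measurableTypeR R] (rV_head w) by [].
  have : [set: 'rV[R]_n] (rV_tail w) by [].
  rewrite FT GT => -[j _ Gj] [i _ Fi]; exists (maxn i j) => //; split.
    exact: (subsetPset _ _ (ndF _ _ (leq_maxl i j))).
  exact: (subsetPset _ _ (ndG _ _ (leq_maxr i j))).
move=> k; have [mF Fk] := Foo k; have [mG Gk] := Goo k; split.
  rewrite -[X in measurable X]setTI.
  by apply: (measurable_rV_uncons _ (measurableX mF mG)).
rewrite /rV_product split_rect product_measure1E//.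
by rewrite lte_mul_pinfty// ge0_fin_numE.
Qed.

HB.instance Definition _ := Measure_isSigmaFinite.Build _ _ _ rV_product
  rV_product_sigma_finite.

End Step.

Fixpoint rV_lebesgue n : {sigma_finite_measure set 'rV[R]_n -> \bar R} :=
  match n with
  | 0 => @dirac _ 'rV[R]_0 0%R R
  | m.+1 => rV_product (rV_lebesgue m)
  end.

Lemma rV_lebesgueS n (A : set 'rV[R]_n.+1) :
  rV_lebesgue n.+1 A = \int[lebesgue_measure]_t rV_lebesgue n [set a | A (rV_cons t a)].
Proof.
rewrite /= /rV_product /product_measure1; apply: eq_integral => t _ /=.
by congr (rV_lebesgue n _); apply/seteqP; split=> a /=; rewrite /xsection/= inE.
Qed.

Lemma rV_lebesgueS' n (A : set 'rV[R]_n.+1) : measurable A ->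
  rV_lebesgue n.+1 A = \int[rV_lebesgue n]_a lebesgue_measure [set t | A (rV_cons t a)].
Proof.
move=> mA; rewrite /= /rV_product.
rewrite (@product_measure_unique _ _ _ _ _ _ _
  (product_measure2 lebesgue_measure (rV_lebesgue n))).
- rewrite /product_measure2; apply: eq_integral => a _ /=.
  by congr (lebesgue_measure _); apply/seteqP; split=> t /=; rewrite /ysection/= inE.
- by move=> A1 A2 m1 m2; exact: product_measure2E.
- by rewrite -[X in measurable X]setTI; exact: measurable_rV_cons.
Qed.

End LebesgueRow.

(** * Invariance of Lebesgue measure under translations and reflections *)

Section RowDot.
Context {R : realType}.
Implicit Types (n : nat).

Definition rV_dot n (a b : 'rV[R]_n) : R := \sum_i a 0 i * b 0 i.

Lemma rV_dotC n (a b : 'rV[R]_n) : rV_dot a b = rV_dot b a.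
Proof. by apply: eq_bigr => i _; rewrite mulrC. Qed.

Lemma rV_dotDl n (a b c : 'rV[R]_n) : rV_dot (a + b) c = rV_dot a c + rV_dot b c.
Proof. by rewrite -big_split; apply: eq_bigr => i _ /=; rewrite mxE mulrDl. Qed.

Lemma rV_dotZl n k (a b : 'rV[R]_n) : rV_dot (k *: a) b = k * rV_dot a b.
Proof. by rewrite mulr_sumr; apply: eq_bigr => i _ /=; rewrite mxE mulrA. Qed.

Lemma rV_dotDr n (a b c : 'rV[R]_n) : rV_dot c (a + b) = rV_dot c a + rV_dot c b.
Proof. by rewrite !(rV_dotC c) rV_dotDl. Qed.

Lemma rV_dotZr n k (a b : 'rV[R]_n) : rV_dot b (k *: a) = k * rV_dot b a.
Proof. by rewrite !(rV_dotC b) rV_dotZl. Qed.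

Lemma rV_dotNl n (a b : 'rV[R]_n) : rV_dot (- a) b = - rV_dot a b.
Proof. by rewrite -scaleN1r rV_dotZl mulN1r. Qed.

Lemma rV_dotNr n (a b : 'rV[R]_n) : rV_dot b (- a) = - rV_dot b a.
Proof. by rewrite !(rV_dotC b) rV_dotNl. Qed.

Lemma rV_dot_cons n s t (a b : 'rV[R]_n) :
  rV_dot (rV_cons s a) (rV_cons t b) = s * t + rV_dot a b.
Proof.
rewrite /rV_dot big_ord_recl; congr (_ + _); last first.
  by apply: eq_bigr => i _; rewrite !rV_consS.
by rewrite -!/(rV_head _) !rV_cons0.
Qed.

Lemma measurable_rV_dot n (a : 'rV[R]_n) :
  measurable_fun [set: 'rV[R]_n] (fun x => rV_dot a x : measurableTypeR R).
Proof.
apply: (@measurable_sum _ _ _ _ _ _ (fun i (x : 'rV[R]_n) => a 0 i * x 0 i)) => i.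
by apply: measurable_funM => //; exact: measurable_coord.
Qed.

End RowDot.

Section LebesgueLine.
Context {R : realType}.
Notation mu := (@lebesgue_measure R).

Lemma lebesgue_measure_translate c (B : set (measurableTypeR R)) :
  measurable B -> mu [set t | B (t + c)] = mu B.
Proof.
move=> mB; have mc : measurable_fun setT (fun t : measurableTypeR R => t + c : measurableTypeR R).
  exact: measurable_funD.
apply/esym/(@lebesgue_measure_unique R
  (pushforward mu (fun t : measurableTypeR R => t + c : measurableTypeR R))) => //.
move=> _ [[a b] _ <-] /=.
rewrite /pushforward (_ : _ @^-1` _ = `]a - c, b - c]%classic).
  rewrite !lebesgue_measure_itv/= !lte_fin ltrD2r; case: ifP => // _.
  by rewrite -!EFinD; congr (_%:E); ring.
by apply/seteqP; split=> t /=; rewrite !in_itv/= ltrBlDr lerBrDr.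
Qed.

Lemma lebesgue_measure_flip c (B : set (measurableTypeR R)) :
  measurable B -> mu [set t | B (c - t)] = mu B.
Proof.
move=> mB; rewrite -(lebesgue_measureN mB) /pushforward.
rewrite -(@lebesgue_measure_translate (- c) [set t | B (- t)]); last first.
  have mN : measurable_fun setT (fun t : measurableTypeR R => - t : measurableTypeR R).
    exact: measurable_funN.
  by rewrite -[X in measurable X]setTI; exact: mN.
by congr (mu _); apply/seteqP; split=> t /=; rewrite opprB.
Qed.

End LebesgueLine.

Section Invariance.
Context {R : realType}.
Local Notation leb := (@rV_lebesgue R).

Lemma measurable_fun_rV_cons n d (T : measurableType d) (f : T -> R) (g : T -> 'rV[R]_n) :
  measurable_fun setT (f : T -> measurableTypeR R) -> measurable_fun setT g ->
  measurable_fun setT (fun x => rV_cons (f x) (g x)).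
Proof.
move=> mf mg; apply: (measurableT_comp
  (f := fun p : measurableTypeR R * 'rV[R]_n => rV_cons p.1 p.2)
  (g := fun x => (f x, g x))); first exact: measurable_rV_cons.
exact: measurable_fun_pair.
Qed.

Lemma measurable_row_section n (A : set 'rV[R]_n.+1) t : measurable A ->
  measurable [set a | A (rV_cons t a)].
Proof.
have mt : measurable_fun setT (fun a : 'rV[R]_n => rV_cons t a).
  exact: measurable_fun_rV_cons.
by move=> mA; rewrite -[X in measurable X]setTI; exact: mt.
Qed.

Lemma measurable_col_section n (A : set 'rV[R]_n.+1) (a : 'rV[R]_n) : measurable A ->
  measurable [set t : measurableTypeR R | A (rV_cons t a)].
Proof.
have ma : measurable_fun setT (fun t : measurableTypeR R => rV_cons t a).
  exact: measurable_fun_rV_cons.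
by move=> mA; rewrite -[X in measurable X]setTI; exact: ma.
Qed.

Definition measure_preserving n (f : 'rV[R]_n -> 'rV[R]_n) :=
  measurable_fun setT f /\ forall A, measurable A -> leb n (f @^-1` A) = leb n A.

Lemma measure_preserving_comp n (f g : 'rV[R]_n -> 'rV[R]_n) :
  measure_preserving f -> measure_preserving g -> measure_preserving (f \o g).
Proof.
move=> [mf fP] [mg gP]; split; first exact: measurableT_comp.
move=> A mA; rewrite comp_preimage gP ?fP//.
by rewrite -[X in measurable X]setTI; exact: mf.
Qed.

(** Tonelli with the first coordinate outermost: a map that fixes the first
    coordinate preserves volume as soon as it does so on each slice. *)
Lemma measure_preserving_rows n (T : R -> 'rV[R]_n -> 'rV[R]_n) :
  measurable_fun setT (fun w => rV_cons (rV_head w) (T (rV_head w) (rV_tail w))) ->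
  (forall t, measure_preserving (T t)) ->
  measure_preserving (fun w => rV_cons (rV_head w) (T (rV_head w) (rV_tail w))).
Proof.
move=> mT TP; split=> // A mA; rewrite !rV_lebesgueS; apply: eq_integral => t _.
rewrite -[RHS](TP t).2; last exact: measurable_row_section.
by congr (leb n _); apply/seteqP; split=> a /=; rewrite rV_cons0 rV_consK.
Qed.

(** Tonelli in the other order, for maps that only move the first coordinate. *)
Lemma measure_preserving_cols n (T : 'rV[R]_n -> R -> R) :
  measurable_fun setT (fun w => rV_cons (T (rV_tail w) (rV_head w)) (rV_tail w)) ->
  (forall a (B : set (measurableTypeR R)), measurable B ->
    lebesgue_measure (T a @^-1` B) = lebesgue_measure B) ->
  measure_preserving (fun w => rV_cons (T (rV_tail w) (rV_head w)) (rV_tail w)).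
Proof.
move=> mT TP; split=> // A mA; rewrite !rV_lebesgueS'//; last first.
  by rewrite -[X in measurable X]setTI; exact: mT.
apply: eq_integral => a _; rewrite -[RHS](TP a); last exact: measurable_col_section.
by congr (lebesgue_measure _); apply/seteqP; split=> t /=; rewrite rV_cons0 rV_consK.
Qed.

Lemma measurable_fun_rVD n d (T : measurableType d) (f g : T -> 'rV[R]_n) :
  measurable_fun setT f -> measurable_fun setT g ->
  measurable_fun setT (fun x => f x + g x).
Proof.
move=> mf mg; apply: measurable_fun_rV => i; under eq_fun do rewrite mxE.
by apply: measurable_funD; exact: (measurableT_comp (measurable_coord i)).
Qed.

Lemma measurable_fun_rVZ n d (T : measurableType d) (f : T -> R) (g : T -> 'rV[R]_n) :
  measurable_fun setT (f : T -> measurableTypeR R) -> measurable_fun setT g ->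
  measurable_fun setT (fun x => f x *: g x).
Proof.
move=> mf mg; apply: measurable_fun_rV => i; under eq_fun do rewrite mxE.
by apply: measurable_funM => //; exact: (measurableT_comp (measurable_coord i)).
Qed.

Lemma measurable_rV_head n : measurable_fun [set: 'rV[R]_n.+1]
  (fun w => rV_head w : measurableTypeR R).
Proof. exact: measurable_coord. Qed.

Lemma measure_preserving_translate n (b : 'rV[R]_n) :
  measure_preserving (fun a => a + b).
Proof.
elim: n b => [|n IHn] b.
  rewrite (_ : (fun a => a + b) = id).
    by split=> //; exact: measurable_id.
  by apply/funext => a; rewrite [RHS]thinmx0 thinmx0.
pose f (w : 'rV[R]_n.+1) := rV_cons (rV_head w) (rV_tail w + rV_tail b).
pose g (w : 'rV[R]_n.+1) := rV_cons (rV_head w + rV_head b) (rV_tail w).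
rewrite (_ : (fun a => _) = f \o g); last first.
  by apply/funext => w; rewrite /f /g /= rV_cons0 rV_consK -rV_consD !rV_eta.
apply: measure_preserving_comp.
  apply: (@measure_preserving_rows _ (fun _ a => a + rV_tail b)) => [|t]; last exact: IHn.
  apply: measurable_fun_rV_cons; first exact: measurable_rV_head.
  by apply: measurable_fun_rVD => //; exact: measurable_rV_tail.
apply: (@measure_preserving_cols _ (fun _ t => t + rV_head b)) => [|a B mB].
  apply: measurable_fun_rV_cons; last exact: measurable_rV_tail.
  by apply: measurable_funD => //; exact: measurable_rV_head.
exact: lebesgue_measure_translate.
Qed.

(** An affine reflection along v.  If v has no first component it reflects each
    slice.  Otherwise the shear that straightens v to the first basis vector
    conjugates it to a flip of the first coordinate alone; shears translate
    slices.  The constant c is there for the induction: the reflection of a slice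
    is affine even when the original one is linear. *)
Lemma measure_preserving_reflection n (l v : 'rV[R]_n) c : rV_dot l v = 2 ->
  measure_preserving (fun w => w - (rV_dot l w + c) *: v).
Proof.
elim: n l v c => [|n IHn] l v c lv.
  by have := lv; rewrite /rV_dot big_ord0 => /eqP; rewrite eq_sym pnatr_eq0.
have [v0|v0] := eqVneq (rV_head v) 0.
  pose T t (a : 'rV[R]_n) :=
    a - (rV_dot (rV_tail l) a + (rV_head l * t + c)) *: rV_tail v.
  rewrite (_ : (fun w => _) =
    (fun w => rV_cons (rV_head w) (T (rV_head w) (rV_tail w)))).
    apply: measure_preserving_rows => [|t].
      apply: measurable_fun_rV_cons; first exact: measurable_rV_head.
      rewrite /T; apply: measurable_fun_rVD; first exact: measurable_rV_tail.
      under eq_fun do rewrite -scaleNr.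
      apply: measurable_fun_rVZ => //; apply: measurable_funN.
      apply: measurable_funD.
        exact: (measurableT_comp (measurable_rV_dot _) (@measurable_rV_tail _ _)).
      apply: measurable_funD => //; apply: measurable_funM => //.
      exact: measurable_rV_head.
    apply: IHn; rewrite -lv -[in RHS](rV_eta l) -[in RHS](rV_eta v).
    by rewrite rV_dot_cons v0 mulr0 add0r.
  apply/funext => w; rewrite -{1 2}(rV_eta w) -{1}(rV_eta l) -{1}(rV_eta v).
  rewrite rV_dot_cons -scaleNr rV_consZ rV_consD v0 mulr0 addr0 /T -scaleNr.
  by congr (rV_cons _ (_ + (- _) *: _)); ring.
(* normalise the vector so that its first coordinate is 1 *)
wlog v1 : l v c lv v0 / rV_head v = 1.
  move=> H.
  have -> : (fun w => w - (rV_dot l w + c) *: v) = (fun w => w -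
     (rV_dot (rV_head v *: l) w + rV_head v * c) *: ((rV_head v)^-1 *: v)).
    apply/funext => w; rewrite rV_dotZl scalerA; congr (_ - _ *: _).
    by field.
  have hv : rV_head ((rV_head v)^-1 *: v) = 1 by rewrite /rV_head mxE mulVf.
  apply: H => //; last by rewrite hv oner_neq0.
  by rewrite rV_dotZl rV_dotZr lv; field.
(* S is the shear that maps the first basis vector to v, and S' is its inverse *)
pose u := rV_tail v.
pose S (w : 'rV[R]_n.+1) := rV_cons (rV_head w) (rV_tail w + rV_head w *: u).
pose S' (w : 'rV[R]_n.+1) := rV_cons (rV_head w) (rV_tail w - rV_head w *: u).
pose U (w : 'rV[R]_n.+1) :=
  rV_cons (- (rV_dot (rV_tail l) (rV_tail w) + c) - rV_head w) (rV_tail w).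
rewrite (_ : (fun w => _) = S \o U \o S'); last first.
  apply/funext => w; rewrite -{1 2}(rV_eta w) -{1}(rV_eta l) -{1}(rV_eta v).
  rewrite rV_dot_cons v1 /S /U /S' /= !rV_cons0 !rV_consK -scaleNr rV_consZ rV_consD.
  move: lv; rewrite -[l]rV_eta -[v]rV_eta rV_dot_cons v1 !rV_consK !rV_cons0 -/u => lu.
  rewrite rV_dotDr rV_dotNr rV_dotZr; congr (rV_cons _ _).
    have -> : rV_dot (rV_tail l) u = 2 - rV_head l * 1 by rewrite -lu; ring.
    ring.
  rewrite -[- (rV_head w *: u)]scaleNr -[RHS]addrA -scalerDl; congr (_ + _ *: _).
  have -> : rV_dot (rV_tail l) u = 2 - rV_head l * 1 by rewrite -lu; ring.
  ring.
have Sm k : measure_preserving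
    (fun w => rV_cons (rV_head w) (rV_tail w + rV_head w *: (k *: u))).
  apply: (@measure_preserving_rows _ (fun t a => a + t *: (k *: u))) => [|t].
    apply: measurable_fun_rV_cons; first exact: measurable_rV_head.
    apply: measurable_fun_rVD; first exact: measurable_rV_tail.
    by apply: measurable_fun_rVZ => //; exact: measurable_rV_head.
  exact: measure_preserving_translate.
apply: measure_preserving_comp; last first.
  have := Sm (-1); rewrite scaleN1r.
  by under eq_fun do rewrite scalerN.
apply: measure_preserving_comp.
  by have := Sm 1; rewrite scale1r.
apply: (@measure_preserving_cols _ (fun a t => - (rV_dot (rV_tail l) a + c) - t))
    => [|a B mB]; last exact: lebesgue_measure_flip.
apply: measurable_fun_rV_cons; last exact: measurable_rV_tail.
apply: measurable_funB; last exact: measurable_rV_head.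
apply: measurable_funN; apply: measurable_funD => //.
exact: (measurableT_comp (measurable_rV_dot _) (@measurable_rV_tail _ _)).
Qed.

End Invariance.

(** * Boxes and slabs *)

Section Boxes.
Context {R : realType}.
Local Notation leb := (@rV_lebesgue R).

Definition rV_box n (r : R) : set 'rV[R]_n := [set a | forall i, `|a 0 i| < r].

Lemma rV_boxS n r (w : 'rV[R]_n.+1) :
  rV_box r w <-> `|rV_head w| < r /\ rV_box r (rV_tail w).
Proof.
split=> [bw|[b0 bt] i].
  by split=> [|i]; [exact: bw|rewrite mxE; exact: bw].
by case: (unliftP ord0 i) => [j|] -> //; have := bt j; rewrite mxE.
Qed.

Let measurable_ball (r : R) : measurable [set t : measurableTypeR R | `|t| < r].
Proof.
have -> : [set t : measurableTypeR R | `|t| < r] = `]-r, r[%classic.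
  by apply/seteqP; split=> t /=; rewrite in_itv/= ltr_norml.
exact: measurable_itv.
Qed.

Let lebesgue_ball (r : R) : 0 < r ->
  lebesgue_measure [set t : measurableTypeR R | `|t| < r] = (2 * r)%:E.
Proof.
move=> r0; have -> : [set t : measurableTypeR R | `|t| < r] = `]-r, r[%classic.
  by apply/seteqP; split=> t /=; rewrite in_itv/= ltr_norml.
rewrite lebesgue_measure_itv/= lte_fin -EFinD ifT; last by lra.
by congr (_%:E); ring.
Qed.

Lemma measurable_rV_box n r : measurable (@rV_box n r).
Proof.
elim: n => [|n IHn].
  rewrite (_ : rV_box r = setT); first exact: measurableT.
  by apply/seteqP; split=> // a _ [].
have -> : @rV_box n.+1 r =
    (fun w => (rV_head w : measurableTypeR R, rV_tail w)) @^-1`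
      ([set t | `|t| < r] `*` rV_box r).
  by apply/seteqP; split=> w /=; rewrite rV_boxS.
rewrite -[X in measurable X]setTI; apply: measurable_rV_uncons => //.
exact: measurableX.
Qed.

Lemma lebesgue_rV_box n r : 0 < r -> leb n (rV_box r) = ((2 * r) ^+ n)%:E.
Proof.
move=> r0; elim: n => [|n IHn] /=.
  by rewrite diracE expr0 mem_set// => -[].
rewrite /rV_product (_ : [set p | _] = [set t | `|t| < r] `*` rV_box r); last first.
  by apply/seteqP; split=> -[t a] /=; rewrite rV_boxS rV_cons0 rV_consK.
rewrite product_measure1E//; last exact: measurable_rV_box.
by rewrite IHn exprS EFinM; congr (_ * _)%E; exact: lebesgue_ball.
Qed.

Lemma lebesgue_contains_box n r b (A : set 'rV[R]_n) : measurable A -> 0 < r ->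
  (forall a, rV_box r a -> A (a + b)) -> (((2 * r) ^+ n)%:E <= leb n A)%E.
Proof.
move=> mA r0 boxA; rewrite -lebesgue_rV_box//.
have [mt tP] := measure_preserving_translate b; rewrite -(tP A mA).
apply: le_measure; rewrite ?inE//; first exact: measurable_rV_box.
by rewrite -[X in measurable X]setTI; exact: mt.
Qed.

Lemma measurable_col_measure n (A : set 'rV[R]_n.+1) : measurable A ->
  measurable_fun setT
    (fun a => lebesgue_measure [set t : measurableTypeR R | A (rV_cons t a)]).
Proof.
move=> mA; have mB : measurable [set p : measurableTypeR R * 'rV[R]_n | A (rV_cons p.1 p.2)].
  by rewrite -[X in measurable X]setTI; exact: measurable_rV_cons.
have := measurable_fun_ysection (@lebesgue_measure R) mB.
rewrite (_ : _ \o _ =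
  (fun a => lebesgue_measure [set t : measurableTypeR R | A (rV_cons t a)]))//.
apply/funext => a /=; congr (lebesgue_measure _).
by apply/seteqP; split=> t /=; rewrite /ysection/= inE.
Qed.

(** A set that lies over a box and within e of a graph is thin in the direction of
    the first coordinate.  This serves both for finiteness of volumes (with the
    zero graph) and for their continuity. *)
Lemma lebesgue_slab n (r e : R) (c : 'rV[R]_n -> R) (A : set 'rV[R]_n.+1) :
  measurable A -> 0 < r -> 0 <= e ->
  (forall w, A w -> rV_box r (rV_tail w) /\ `|rV_head w - c (rV_tail w)| <= e) ->
  (leb n.+1 A <= (2 * e * (2 * r) ^+ n)%:E)%E.
Proof.
move=> mA r0 e0 Aslab; rewrite rV_lebesgueS'//.
apply: (@le_trans _ _ (\int[leb n]_(a in setT) ((2 * e)%:E * (\1_(@rV_box n r) a)%:E)%E)%E).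
  apply: ge0_le_integral => //.
  - exact: measurable_col_measure.
  - apply: emeasurable_funM => //; apply/measurable_EFinP.
    by apply: measurable_indic; exact: measurable_rV_box.
  move=> a _; have [ba|ba] := pselect (@rV_box n r a).
    rewrite indicE mem_set// mule1.
    have -> : (2 * e)%:E = lebesgue_measure `[c a - e, c a + e]%classic.
      rewrite lebesgue_measure_itv/= lte_fin -EFinD.
      case: ifP => [_|]; first by congr (_%:E); ring.
      move/negbT; rewrite -leNgt => ?; congr (_%:E); lra.
    apply: le_measure; rewrite ?inE.
    - exact: measurable_col_section.
    - exact: measurable_itv.
    move=> t /= /Aslab []; rewrite rV_cons0 rV_consK => _.
    by rewrite in_itv/= ler_norml => /andP[? ?]; apply/andP; split; lra.
  rewrite (_ : [set t | _] = set0) ?measure0 ?indicE ?memNset ?mule0//.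
  by rewrite -subset0 => t /= /Aslab []; rewrite rV_consK.
rewrite ge0_integralZl//; last 2 first.
- by apply/measurable_EFinP; apply: measurable_indic; exact: measurable_rV_box.
- by rewrite lee_fin mulr_ge0.
rewrite integral_indic// ?setIT; last exact: measurable_rV_box.
rewrite [X in (_ * X)%E](_ : leb n (@rV_box n r) = ((2 * r) ^+ n)%:E); first by rewrite -EFinM.
exact: lebesgue_rV_box.
Qed.

End Boxes.

(** * Acausal functions and the volume between them *)

Section Estimates.
Context {R : realType}.
Implicit Types (n : nat).

Lemma rV_dot_ge0 n (a : 'rV[R]_n) : 0 <= rV_dot a a.
Proof. by apply: sumr_ge0 => i _; rewrite -expr2 sqr_ge0. Qed.

Lemma rV_dot_CauchySchwarz n (a b : 'rV[R]_n) :
  rV_dot a b ^+ 2 <= rV_dot a a * rV_dot b b.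
Proof.
have := sum_CauchySchwarz (fun i => a 0 i) (fun i => b 0 i).
by under [X in _ <= X * _]eq_bigr do rewrite expr2;
   under [X in _ <= _ * X]eq_bigr do rewrite expr2.
Qed.

Lemma rV_coord_le n (a : 'rV[R]_n) i : a 0 i ^+ 2 <= rV_dot a a.
Proof.
rewrite /rV_dot (bigD1 i)//= expr2 lerDl.
by apply: sumr_ge0 => j _; rewrite -expr2 sqr_ge0.
Qed.

(** Since e ^+ 2 <= e for e <= 1, this linear bound spares square roots. *)
Lemma rV_dot_box n e (a : 'rV[R]_n) : rV_box e a -> e <= 1 ->
  rV_dot a a <= n%:R * e.
Proof.
move=> ba e1; rewrite -[n in n%:R]card_ord mulr_natl -sumr_const.
apply: ler_sum => i _; have := ba i; have := normr_ge0 (a 0 i).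
by rewrite -expr2 -real_normK ?num_real//; nra.
Qed.

Lemma rV_rational_approx n e (a : 'rV[R]_n) : 0 < e ->
  exists q : 'rV[rat]_n, rV_dot (a - map_mx ratr q) (a - map_mx ratr q) < e.
Proof.
move=> e0; pose d := Num.min 1 (e / n.+1%:R).
have d0 : 0 < d by rewrite lt_min ltr01 divr_gt0// ltr0n.
have /fin_all_exists[q qP] i : exists q : rat, `|a 0 i - ratr q| < d.
  have [q] := @rat_in_itvoo R (a 0 i - d) (a 0 i + d) ltac:(lra).
  by rewrite in_itv/= => /andP[? ?]; exists q; rewrite ltr_norml; lra.
exists (\row_i q i).
apply: (@le_lt_trans _ _ (n%:R * d)).
  by apply: rV_dot_box; rewrite ?ge_min ?lexx// => i; rewrite !mxE.
apply: (@lt_le_trans _ _ (n.+1%:R * d)); first by rewrite ltr_pM2r// ltr_nat.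
by rewrite mulrC -ler_pdivlMr ?ltr0n// ge_min lexx orbT.
Qed.

Lemma minkowskiE n (x y : 'rV[R]_n.+1) :
  minkowski x y = rV_dot (rV_tail x) (rV_tail y) - rV_head x * rV_head y.
Proof.
by rewrite /minkowski; congr (_ - _); apply: eq_bigr => i _; rewrite !mxE.
Qed.

Lemma sqr_le_normr (x y : R) : 0 <= y -> x ^+ 2 <= y ^+ 2 -> `|x| <= y.
Proof. by move=> y0 xy; rewrite -(@ler_pXn2r _ 2) ?nnegrE// real_normK// num_real. Qed.

Lemma sqr_lt_normr (x y : R) : 0 <= y -> x ^+ 2 < y ^+ 2 -> `|x| < y.
Proof. by move=> y0 xy; rewrite -(@ltr_pXn2r _ 2) ?nnegrE// real_normK// num_real. Qed.

End Estimates.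

Section Acausal.
Context {R : realType}.
Implicit Types (n : nat) (K : R).

(** The graph of F is a homogeneous hypersurface of Minkowski space, and the second
    clause says that no two of its points are timelike related: equivalently, that the
    half-spaces below F meet pairwise.  The third clause bounds the
    slope of F by the square root of K / (1 + K), which is smaller than 1; it is
    stated so as to compare the time coordinate with the Minkowski square, since this
    form is preserved, up to the constant, by Lorentz transformations. *)
Definition acausal_with K n (F : 'rV[R]_n -> R) : Prop :=
  [/\ forall t a, F (t *: a) = t * F a,
      forall a b, (F a - F b) ^+ 2 <= rV_dot (a - b) (a - b)
    & forall a, F a ^+ 2 <= K * (rV_dot a a - F a ^+ 2)].

Definition is_acausal n : pred ('rV[R]_n -> R) :=
  fun F => `[< exists2 K, 0 <= K & acausal_with K F >].

Definition below n (F : 'rV[R]_n -> R) (w : 'rV[R]_n.+1) : bool :=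
  rV_head w < F (rV_tail w).

(** Vectors between two acausal graphs are spacelike, so this set describes half-spaces.
    Truncating at Minkowski square 1 bounds it, in a Lorentz invariant way. *)
Definition separated n (F G : 'rV[R]_n -> R) : set 'rV[R]_n.+1 :=
  [set w | (minkowski w w < 1) && (below F w != below G w)].

Definition volume_between n (F G : 'rV[R]_n -> R) : R :=
  fine (rV_lebesgue n.+1 (separated F G)).

Lemma measurable_lt_set d (T : measurableType d) (f g : T -> R) :
  measurable_fun setT f -> measurable_fun setT g ->
  measurable [set x | f x < g x].
Proof.
move=> mf mg; have := @measurable_lte _ _ R setT measurableT (EFin \o f) (EFin \o g).
rewrite setTI; apply; exact/measurable_EFinP.
Qed.

Lemma measurable_minkowski n : measurable_fun setT
  (fun w : 'rV[R]_n.+1 => minkowski w w).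
Proof.
apply: measurable_funB; first apply: (measurable_sum (index_enum 'I_n)) => i.
  by apply: measurable_funM; exact: measurable_coord.
by apply: measurable_funM; exact: measurable_coord.
Qed.

(** The set below a 1-Lipschitz graph is the union of the past cones of the points
    of the graph over rational vectors. *)
Lemma measurable_below n (F : 'rV[R]_n -> R) :
  (forall a b, (F a - F b) ^+ 2 <= rV_dot (a - b) (a - b)) ->
  measurable [set w | below F w].
Proof.
move=> Flip.
pose C (q : 'rV[rat]_n) : set 'rV[R]_n.+1 :=
  [set w | rV_head w < F (map_mx ratr q)] `&`
  [set w | rV_dot (rV_tail w - map_mx ratr q) (rV_tail w - map_mx ratr q) <
    (F (map_mx ratr q) - rV_head w) ^+ 2].
have -> : [set w | below F w] = \bigcup_q C q.
  apply/seteqP; split=> w.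
    rewrite /= /below => wF; set d := F (rV_tail w) - rV_head w.
    have d0 : 0 < d by rewrite subr_gt0.
    have [q qw] := @rV_rational_approx _ _ ((d / 2) ^+ 2) (rV_tail w) ltac:(nra).
    exists q => //; rewrite /C /=.
    have d20 : 0 <= d / 2 by lra.
    have := sqr_lt_normr d20 (le_lt_trans (Flip (rV_tail w) (map_mx ratr q)) qw).
    rewrite ltr_norml => /andP[_ Fq].
    have Fw : d / 2 < F (map_mx ratr q) - rV_head w by rewrite /d in Fq *; lra.
    by split; [rewrite -subr_gt0; lra|nra].
  move=> [q _ [/= hq dq]]; rewrite /below.
  have hq0 : 0 <= F (map_mx ratr q) - rV_head w by rewrite subr_ge0 ltW.
  have := sqr_lt_normr hq0 (le_lt_trans (Flip (rV_tail w) (map_mx ratr q)) dq).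
  by rewrite ltr_norml => /andP[+ _]; lra.
apply: countable_bigcupT_measurable => [|q]; first exact: countableP.
apply: measurableI; apply: measurable_lt_set => //.
- exact: measurable_coord.
- apply: (measurable_sum (index_enum 'I_n)) => i.
  have mi : measurable_fun setT
      (fun w : 'rV[R]_n.+1 => (rV_tail w - map_mx ratr q) 0 i).
    under eq_fun do rewrite mxE; apply: measurable_funD => //.
    exact: (measurableT_comp (measurable_coord i) (@measurable_rV_tail _ _)).
  exact: measurable_funM.
- apply: measurable_funX; apply: measurable_funB => //; exact: measurable_coord.
Qed.

Section Separation.
Variable n : nat.
Implicit Types F G H : 'rV[R]_n -> R.

Lemma acausal0 K F : acausal_with K F -> F 0 = 0.
Proof. by move=> [FZ _ _]; rewrite -(scale0r 0) FZ mul0r. Qed.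

Lemma acausal_spacelike K F a : acausal_with K F -> F a ^+ 2 <= rV_dot a a.
Proof.
move=> aF; have [_ lip _] := aF.
by have := lip a 0; rewrite (acausal0 aF) !subr0.
Qed.

Lemma acausal_weaken K K' F : K <= K' -> acausal_with K F -> acausal_with K' F.
Proof.
move=> KK' aF; have [FZ lip FK] := aF; split=> // a.
have := FK a; have := acausal_spacelike a aF; nra.
Qed.

Lemma measurable_separated K F G : acausal_with K F -> acausal_with K G ->
  measurable (separated F G).
Proof.
move=> [_ lF _] [_ lG _].
have -> : separated F G = [set w | minkowski w w < 1] `&`
    (([set w | below F w] `\` [set w | below G w]) `|`
     ([set w | below G w] `\` [set w | below F w])).
  apply/seteqP; split=> w; rewrite /separated /=.
    by move=> /andP[-> bw]; split=> //; move: bw;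
      case: (below F w); case: (below G w) => // _; [left|right].
  by move=> [->]; case: (below F w); case: (below G w) => //= -[[]|[]].
apply: measurableI.
  by apply: measurable_lt_set => //; exact: measurable_minkowski.
by apply: measurableU; apply: measurableD; exact: measurable_below.
Qed.

(** A vector between two graphs is at most as steep as one of them. *)
Lemma separated_bound K F G w : 0 <= K -> acausal_with K F -> acausal_with K G ->
  separated F G w -> rV_head w ^+ 2 <= K * minkowski w w.
Proof.
move=> K0 [_ _ FK] [_ _ GK] /andP[_]; rewrite /below minkowskiE.
have := FK (rV_tail w); have := GK (rV_tail w).
set f := F _; set g := G _; set d := rV_dot _ _; set h := rV_head w.
move=> gK fK; have hfg : h ^+ 2 <= f ^+ 2 \/ h ^+ 2 <= g ^+ 2 -> h ^+ 2 <= K * (d - h * h).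
  by rewrite -expr2; move=> [?|?]; nra.
case: (ltP h f) => fh; case: (ltP h g) => gh // _; apply: hfg.
  by case: (leP 0 h) => h0; [left|right]; nra.
by case: (leP 0 h) => h0; [right|left]; nra.
Qed.

Lemma separated_box K F G w : 0 <= K -> acausal_with K F -> acausal_with K G ->
  separated F G w -> `|rV_head w| <= K + 2 /\ rV_box (K + 2) (rV_tail w).
Proof.
move=> K0 aF aG sw; have hb := separated_bound K0 aF aG sw.
have /andP[q1 _] := sw.
have hK : rV_head w ^+ 2 <= K by apply: (le_trans hb); nra.
split; first by apply: sqr_le_normr; nra.
move=> i; have := rV_coord_le (rV_tail w) i; move: q1; rewrite minkowskiE => q1 cw.
by apply: sqr_lt_normr; nra.
Qed.

Lemma volume_separated_le K F G : 0 <= K -> acausal_with K F -> acausal_with K G ->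
  (rV_lebesgue n.+1 (separated F G) <= (2 * (K + 2) * (2 * (K + 2)) ^+ n)%:E)%E.
Proof.
move=> K0 aF aG.
apply: (@lebesgue_slab _ _ _ _ (fun=> 0)); [exact: measurable_separated aF aG|lra|lra|].
by move=> w /(separated_box K0 aF aG)[? ?]; rewrite subr0.
Qed.

Lemma volume_betweenE K F G : 0 <= K -> acausal_with K F -> acausal_with K G ->
  rV_lebesgue n.+1 (separated F G) = (volume_between F G)%:E.
Proof.
move=> K0 aF aG; rewrite fineK// ge0_fin_numE ?measure_ge0//.
by apply: (le_lt_trans (volume_separated_le K0 aF aG)); exact: ltry.
Qed.

Lemma volume_between_bounded K F G : 0 <= K -> acausal_with K F -> acausal_with K G ->
  volume_between F G <= 2 * (K + 2) * (2 * (K + 2)) ^+ n.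
Proof.
move=> K0 aF aG; rewrite -lee_fin -(volume_betweenE K0 aF aG).
exact: volume_separated_le.
Qed.

Lemma volume_between_le K (e : R) F G : 0 <= K -> acausal_with K F -> acausal_with K G ->
  0 <= e -> (forall a, rV_box (K + 2) a -> `|F a - G a| <= e) ->
  volume_between F G <= 2 * e * (2 * (K + 2)) ^+ n.
Proof.
move=> K0 aF aG e0 FG; rewrite -lee_fin -(volume_betweenE K0 aF aG).
apply: (@lebesgue_slab _ _ _ _ F) => //; [exact: measurable_separated aF aG|lra|].
move=> w sw; have [_ bw] := separated_box K0 aF aG sw; split=> //.
have := FG _ bw; move: sw => /andP[_]; rewrite /below.
set h := rV_head w; set f := F _; set g := G _.
by case: (ltP h f) => hf; case: (ltP h g) => hg // _;
  rewrite !ler_norml => /andP[? ?]; apply/andP; split; lra.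
Qed.

Lemma volume_betweenC F G : volume_between F G = volume_between G F.
Proof.
congr (fine (rV_lebesgue _ _)); apply/seteqP.
by split=> w; rewrite /separated /= eq_sym.
Qed.

Lemma volume_betweenxx F : volume_between F F = 0.
Proof.
rewrite /volume_between (_ : separated F F = set0) ?measure0//.
by rewrite -subset0 => w /andP[_]; rewrite eqxx.
Qed.

Lemma volume_between_triangle F G H : is_acausal F -> is_acausal G -> is_acausal H ->
  volume_between F H <= volume_between F G + volume_between G H.
Proof.
move=> /asboolP[k k0 aF] /asboolP[k' k0' aG] /asboolP[k'' k0'' aH].
pose K := k + k' + k''.
have K0 : 0 <= K by rewrite /K; lra.
have {}aF : acausal_with K F by apply: acausal_weaken aF; rewrite /K; lra.
have {}aG : acausal_with K G by apply: acausal_weaken aG; rewrite /K; lra.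
have {}aH : acausal_with K H by apply: acausal_weaken aH; rewrite /K; lra.
rewrite -lee_fin EFinD -!(volume_betweenE K0)//.
apply: (le_trans _ (measureU2 _ _ _)); first apply: le_measure; rewrite ?inE.
- exact: measurable_separated aF aH.
- by apply: measurableU; [exact: measurable_separated aF aG|exact: measurable_separated aG aH].
- move=> w /andP[q]; rewrite /separated /= q /=.
  by case: (below F w); case: (below G w); case: (below H w) => //= _; by [left|right].
- exact: measurable_separated aF aG.
- exact: measurable_separated aG aH.
Qed.

Definition between (x m y : R) := (x <= m <= y) || (y <= m <= x).

(** Since G lies between F and H, it agrees on each half-space with one of them, so that a
    half-space separating F from H separates G from exactly one of them. *)
Lemma volume_between_additive F G H : is_acausal F -> is_acausal G -> is_acausal H ->
  (forall a, between (F a) (G a) (H a)) ->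
  volume_between F H = volume_between F G + volume_between G H.
Proof.
move=> /asboolP[k k0 aF] /asboolP[k' k0' aG] /asboolP[k'' k0'' aH] FGH.
pose K := k + k' + k''.
have K0 : 0 <= K by rewrite /K; lra.
have {}aF : acausal_with K F by apply: acausal_weaken aF; rewrite /K; lra.
have {}aG : acausal_with K G by apply: acausal_weaken aG; rewrite /K; lra.
have {}aH : acausal_with K H by apply: acausal_weaken aH; rewrite /K; lra.
apply/EFin_inj; rewrite EFinD -!(volume_betweenE K0)//.
have bw w : [\/ below F w = below G w | below G w = below H w].
  have := FGH (rV_tail w); rewrite /between /below.
  set h := rV_head w; set f := F _; set g := G _; set l := H _.
  by case: (ltP h f) => hf; case: (ltP h g) => hg; case: (ltP h l) => hl;
    try (by move=> _; constructor); move=> /orP[] /andP[? ?]; lra.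
rewrite -measureU; [|exact: measurable_separated aF aG|exact: measurable_separated aG aH|].
  congr (rV_lebesgue _ _); apply/seteqP; split=> w; rewrite /separated /=.
    move=> /andP[->] /=; case: (bw w) => ->; first by right.
    by left.
  by case=> /andP[->] /=; case: (bw w) => ->; rewrite ?eqxx.
rewrite -subset0 => w [/andP[_ +] /andP[_]].
by case: (bw w) => ->; rewrite ?eqxx.
Qed.

(** A vertical gap 4 * d over a short vector a persists nearby, because F and G are
    1-Lipschitz; hence the separating set contains a box of a size that depends
    on d only.  The bound on a keeps this box below Minkowski square 1. *)
Lemma volume_between_ge (d : R) F G a : is_acausal F -> is_acausal G ->
  0 < d <= 4^-1 -> rV_dot a a <= 4^-1 -> F a + 4 * d <= G a ->
  (2 * (d ^+ 2 / n.+1%:R)) ^+ n.+1 <= volume_between F G.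
Proof.
move=> /asboolP[k k0 aF] /asboolP[k' k0' aG] /andP[d0 d4] a4 FG.
pose K := k + k'.
have K0 : 0 <= K by rewrite /K; lra.
have {}aF : acausal_with K F by apply: acausal_weaken aF; rewrite /K; lra.
have {}aG : acausal_with K G by apply: acausal_weaken aG; rewrite /K; lra.
rewrite -lee_fin -(volume_betweenE K0)//.
set r := d ^+ 2 / n.+1%:R.
have r0 : 0 < r by rewrite divr_gt0 ?ltr0n ?exprn_gt0.
have nr : n.+1%:R * r = d ^+ 2 by rewrite mulrC divfK// pnatr_eq0.
have n1 : 1 <= n.+1%:R :> R by rewrite ler1n.
have rd : r <= d by nra.
pose c := (F a + G a) / 2.
apply: (@lebesgue_contains_box _ _ _ (rV_cons c a)) => //.
  exact: measurable_separated aF aG.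
move=> w /rV_boxS[hw tw].
have dw : rV_dot (rV_tail w) (rV_tail w) <= d ^+ 2.
  apply: (le_trans (rV_dot_box tw _)); first lra.
  by rewrite -nr ler_pM2r// ler_nat.
rewrite -[w]rV_eta rV_consD /separated /= /below !rV_cons0 !rV_consK minkowskiE.
rewrite !rV_cons0 !rV_consK.
have [_ lF _] := aF; have [_ lG _] := aG.
have hF := le_trans (lF (rV_tail w + a) a) ltac:(rewrite addrK; exact: dw).
have hG := le_trans (lG (rV_tail w + a) a) ltac:(rewrite addrK; exact: dw).
move/(sqr_le_normr (ltW d0)): hF; move/(sqr_le_normr (ltW d0)): hG.
move: hw; rewrite ltr_norml !ler_norml => /andP[? ?] /andP[? ?] /andP[? ?].
apply/andP; split.
  apply: (@le_lt_trans _ _ (rV_dot (rV_tail w + a) (rV_tail w + a))).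
    by rewrite gerBl -expr2 sqr_ge0.
  have := rV_dot_ge0 (rV_tail w - a).
  by rewrite !(rV_dotDl, rV_dotDr, rV_dotNl, rV_dotNr) (rV_dotC a (rV_tail w)); nra.
rewrite (_ : (_ < F _) = false); last by apply/negbTE; rewrite -leNgt /c; lra.
by rewrite (_ : (_ < G _) = true)// /c; lra.
Qed.

(** By homogeneity a gap between F and G can be moved over a vector as short as
    desired. *)
Lemma volume_between_eq0 F G : is_acausal F -> is_acausal G ->
  volume_between F G = 0 -> F = G.
Proof.
have key F' G' a : is_acausal F' -> is_acausal G' -> F' a < G' a ->
    volume_between F' G' != 0.
  move=> aF aG FG.
  have [FZ GZ] : (forall t b, F' (t *: b) = t * F' b) /\
      (forall t b, G' (t *: b) = t * G' b).
    by move/asboolP: aF => [? _ []]; move/asboolP: aG => [? _ []].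
  pose t := (2 * (1 + rV_dot a a))^-1.
  have a0 := rV_dot_ge0 a.
  have t0 : 0 < t by rewrite invr_gt0; lra.
  have tE : t * (2 * (1 + rV_dot a a)) = 1 by rewrite mulVf//; lra.
  pose d := Num.min 4^-1 (t * (G' a - F' a) / 4).
  have d0 : 0 < d by rewrite lt_min; apply/andP; split; [lra|nra].
  apply: lt0r_neq0; apply: (@lt_le_trans _ _ ((2 * (d ^+ 2 / n.+1%:R)) ^+ n.+1)).
    by rewrite exprn_gt0// mulr_gt0// divr_gt0 ?ltr0n// exprn_gt0.
  apply: (@volume_between_ge _ _ _ (t *: a)) => //.
  - by rewrite d0 ge_min lexx.
  - by rewrite rV_dotZl rV_dotZr; nra.
  - rewrite FZ GZ; have : d <= t * (G' a - F' a) / 4 by rewrite ge_min lexx orbT.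
    lra.
move=> aF aG v0; apply/funext => a; case: (ltgtP (F a) (G a)) => // FG.
  by have := key _ _ _ aF aG FG; rewrite v0 eqxx.
by have := key _ _ _ aG aF FG; rewrite volume_betweenC v0 eqxx.
Qed.

End Separation.

End Acausal.

(** * Lorentz transformations and isometries of hyperbolic space *)

Section Lorentz.
Context {R : realType} {n : nat}.
Local Notation V := 'rV[R]_n.+1.
Implicit Types (v w z : V) (p q : hyperbolic R n) (M : 'M[R]_n.+1).

Lemma minkowskiZr a w z : minkowski w (a *: z) = a * minkowski w z.
Proof. by rewrite minkowskiC minkowskiZl minkowskiC. Qed.

Lemma minkowskiDr w z v : minkowski v (w + z) = minkowski v w + minkowski v z.
Proof. by rewrite -[w]scale1r minkowskiDZr mul1r scale1r. Qed.

Lemma minkowskiDl w z v : minkowski (w + z) v = minkowski w v + minkowski z v.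
Proof. by rewrite minkowskiC minkowskiDr !(minkowskiC v). Qed.

Lemma minkowskiNl w z : minkowski (- w) z = - minkowski w z.
Proof. by rewrite -scaleN1r minkowskiZl mulN1r. Qed.

Lemma minkowskiNr w z : minkowski w (- z) = - minkowski w z.
Proof. by rewrite minkowskiC minkowskiNl minkowskiC. Qed.

Definition minkowski_linE :=
  (minkowskiDl, minkowskiDr, minkowskiNl, minkowskiNr, @minkowskiZl R n, minkowskiZr).

(** Vectors of square -1 lie on two sheets, and on different sheets the form is
    positive. *)
Lemma on_hyperboloid_sheet p w :
  minkowski w w = -1 -> minkowski p w < 0 -> on_hyperboloid w.
Proof.
move=> ww pw; apply/andP; split; first exact/eqP.
have := ww; rewrite minkowskiE -[w 0 ord0]/(rV_head w) => wE.
have := rV_dot_ge0 (rV_tail w); case: (ltrP 0 (rV_head w)) => // w0 d0.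
have hN : on_hyperboloid (- w).
  rewrite /on_hyperboloid minkowskiNl minkowskiNr opprK ww eqxx /=.
  by rewrite mxE oppr_gt0 -/(rV_head w) lt_neqAle w0 andbT; apply/eqP => h0; rewrite h0 in wE; lra.
by have := hyp_ge1 p (Hyperbolic hN); rewrite /= minkowskiNr; lra.
Qed.

Definition minkowski_dual v : 'cV[R]_n.+1 :=
  \col_i (if i == ord0 then - v 0 i else v 0 i).

Lemma mulmx_minkowski_dual w v : w *m minkowski_dual v = (minkowski w v)%:M.
Proof.
apply/matrixP => i j; rewrite !ord1 !mxE eqxx mulr1n big_ord_recl mxE eqxx.
rewrite /minkowski addrC mulrN; congr (_ - _).
by apply: eq_bigr => k _; rewrite mxE.
Qed.

(** The reflection in the hyperplane orthogonal to v, acting on row vectors from the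
    right. *)
Definition reflection_mx v : 'M[R]_n.+1 :=
  1%:M - (2 / minkowski v v) *: (minkowski_dual v *m v).

Lemma mulmx_reflection w v :
  w *m reflection_mx v = w - (2 / minkowski v v * minkowski w v) *: v.
Proof.
rewrite /reflection_mx mulmxBr mulmx1 -scalemxAr mulmxA mulmx_minkowski_dual.
by rewrite mul_scalar_mx scalerA.
Qed.

Definition lorentz M : Prop :=
  [/\ forall w z, minkowski (w *m M) (z *m M) = minkowski w z,
      forall w, on_hyperboloid w -> on_hyperboloid (w *m M)
    & measure_preserving (fun w => w *m M)].

Lemma lorentz1 : lorentz 1%:M.
Proof.
split=> [w z|w|]; rewrite ?mulmx1//.
rewrite (_ : (fun w => _) = id); first by split=> //; exact: measurable_id.
by apply/funext => w; rewrite mulmx1.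
Qed.

Lemma lorentzM M N : lorentz M -> lorentz N -> lorentz (M *m N).
Proof.
move=> [Mi Mh Mm] [Ni Nh Nm]; split=> [w z|w hw|].
- by rewrite !mulmxA Ni Mi.
- by rewrite mulmxA; apply/Nh/Mh.
rewrite (_ : (fun w => _) = (fun w => w *m N) \o (fun w => w *m M)).
  exact: measure_preserving_comp.
by apply/funext => w /=; rewrite mulmxA.
Qed.

Lemma lorentz_reflection v : 0 < minkowski v v -> lorentz (reflection_mx v).
Proof.
move=> v0; have vn0 : minkowski v v != 0 by rewrite gt_eqF.
have refl_iso w z :
    minkowski (w *m reflection_mx v) (z *m reflection_mx v) = minkowski w z.
  rewrite !mulmx_reflection !minkowski_linE (minkowskiC v z).
  by field.
split=> // [w hw|].
  apply: (@on_hyperboloid_sheet (Hyperbolic hw)).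
    by rewrite refl_iso (hyp_mink (Hyperbolic hw)).
  rewrite /= mulmx_reflection !minkowski_linE (hyp_mink (Hyperbolic hw)).
  have : 0 <= 2 / minkowski v v * minkowski w v * minkowski w v.
    by rewrite -mulrA -expr2 mulr_ge0 ?sqr_ge0// divr_ge0// ltW.
  by lra.
pose l := (2 / minkowski v v) *: rV_cons (- rV_head v) (rV_tail v).
have lE w : rV_dot l w = 2 / minkowski v v * minkowski w v.
  rewrite rV_dotZl; congr (_ * _).
  by rewrite -[in LHS](rV_eta w) rV_dot_cons minkowskiE rV_dotC; ring.
rewrite (_ : (fun w => _) = (fun w => w - (rV_dot l w + 0) *: v)).
  by apply: measure_preserving_reflection; rewrite lE; field.
by apply/funext => w; rewrite mulmx_reflection addr0 lE.
Qed.

Lemma minkowski_hyp_eq p q : minkowski p q = -1 -> p = q.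
Proof.
move=> pq; apply: (mdist_positivity p q).
by rewrite hyp_mdistE pq opprK /arcosh expr1n subrr sqrtr0 addr0 ln1.
Qed.

(** Configurations of points with equal Gram matrices are related by a product of
    reflections: if the points of s are already matched, the reflection exchanging
    the next point with its target fixes them all, since they are equidistant from the
    two. *)
Lemma lorentz_matching (s : seq (hyperbolic R n * hyperbolic R n)) :
  (forall x y, x \in s -> y \in s -> minkowski x.1 y.1 = minkowski x.2 y.2) ->
  exists2 M, lorentz M & forall x, x \in s -> (x.1 : V) *m M = x.2.
Proof.
elim: s => [|x s IHs] sP; first by exists 1%:M => //; exact: lorentz1.
have [|M LM Ms] := IHs; first by move=> y z ys zs; apply: sP; rewrite inE ?ys ?zs orbT.
have [Mi Mh _] := LM.
pose y := Hyperbolic (Mh _ (hypP x.1)).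
pose v : V := (y : V) - (x.2 : V).
have [v0|v0] := eqVneq v 0.
  exists M => // z; rewrite inE => /predU1P[->|/Ms//].
  by apply/eqP; rewrite -subr_eq0; exact/eqP.
have vv : minkowski v v = 2 * (- minkowski y x.2 - 1).
  by rewrite !minkowski_linE !hyp_mink (minkowskiC x.2); ring.
have vv0 : 0 < minkowski v v.
  rewrite vv mulr_gt0// subr_gt0 lt_neqAle hyp_ge1 andbT.
  apply: contra v0 => /eqP yx; rewrite /v subr_eq0; apply/eqP; congr hyp_val.
  by apply: minkowski_hyp_eq; rewrite yx opprK.
exists (M *m reflection_mx v); first exact/lorentzM/lorentz_reflection.
move=> z; rewrite inE mulmxA mulmx_reflection => /predU1P[->|zs].
  rewrite -[_ *m M]/(y : V).
  have -> : minkowski y v = minkowski v v / 2.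
    by rewrite vv !minkowski_linE hyp_mink; field.
  have -> : 2 / minkowski v v * (minkowski v v / 2) = 1.
    by field; rewrite gt_eqF.
  by rewrite scale1r /v opprB addrC subrK.
rewrite (Ms z zs).
have -> : minkowski z.2 v = 0.
  rewrite !minkowski_linE -(Ms z zs) Mi (Ms z zs).
  by rewrite (sP z x) ?inE ?eqxx ?zs ?orbT// subrr.
by rewrite mulr0 scale0r subr0.
Qed.

Lemma arcosh_inj (a b : R) : 1 <= a -> 1 <= b -> arcosh a = arcosh b -> a = b.
Proof.
move=> a1 b1; rewrite /arcosh => /ln_inj; rewrite !posrE.
have := arcosh_arg_ge1 a1; have := arcosh_arg_ge1 b1.
have := sqrtr_ge0 (a ^+ 2 - 1); have := sqrtr_ge0 (b ^+ 2 - 1).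
have := @sqr_sqrtr _ (a ^+ 2 - 1) ltac:(nra).
have := @sqr_sqrtr _ (b ^+ 2 - 1) ltac:(nra).
set s := Num.sqrt _; set t := Num.sqrt _ => s2 t2 s0 t0 bs at1 /(_ _ _)e.
have {}e : a + t = b + s by apply: e; lra.
have : (a + t) * (a - t) = (b + s) * (b - s).
  have -> : (a + t) * (a - t) = a ^+ 2 - t ^+ 2 by ring.
  have -> : (b + s) * (b - s) = b ^+ 2 - s ^+ 2 by ring.
  by rewrite s2 t2; ring.
rewrite e => /mulfI; have bs0 : b + s != 0 by rewrite gt_eqF; lra.
by move=> /(_ bs0); lra.
Qed.

Lemma isom_minkowski (g : isom (hyperbolic R n)) p q :
  minkowski (g p) (g q) = minkowski p q.
Proof.
apply: oppr_inj; apply: arcosh_inj; rewrite ?hyp_ge1//.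
by rewrite -!hyp_mdistE (isom_isometric g).
Qed.

Lemma isom_lorentz_seq (g : isom (hyperbolic R n)) (s : seq (hyperbolic R n)) :
  exists2 M, lorentz M & forall p, p \in s -> (p : V) *m M = g p.
Proof.
have [|M LM MP] := @lorentz_matching [seq (p, g p) | p <- s].
  by move=> _ _ /mapP[p _ ->] /mapP[q _ ->] /=; rewrite isom_minkowski.
by exists M => // p ps; apply: (MP (p, g p)); rewrite map_f.
Qed.

(** A basis of Minkowski space made of points of the hyperboloid. *)
Definition spanning_vector (i : 'I_n.+1) : V :=
  if i == ord0 then delta_mx 0 ord0
  else Num.sqrt 2 *: delta_mx 0 ord0 + delta_mx 0 i.

Lemma minkowski_delta w i :
  minkowski w (delta_mx 0 i) = if i == ord0 then - rV_head w else w 0 i.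
Proof.
rewrite minkowskiE /rV_dot /rV_head mxE eqxx /=.
case: (unliftP ord0 i) => [j|] -> /=.
  rewrite mulr0 subr0 (bigD1 j)//= !mxE !eqxx mulr1 big1 ?addr0// => k kj.
  by rewrite !mxE eqxx /= (inj_eq lift_inj) (negbTE kj) mulr0.
by rewrite mulr1 big1 ?sub0r// => k _; rewrite !mxE mulr0.
Qed.

Lemma spanning_vector_hyp i : on_hyperboloid (spanning_vector i).
Proof.
rewrite /on_hyperboloid /spanning_vector; case: ifPn => i0.
  by rewrite minkowski_delta eqxx /rV_head !mxE /= ltr01 andbT.
rewrite !minkowski_linE !minkowski_delta (negbTE i0) eqxx /rV_head !mxE !eqxx /=.
rewrite (eq_sym ord0) (negbTE i0) /= !(mulr0n, mulrN, mulr0, mulr1, oppr0, addr0, add0r).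
have := @sqr_sqrtr R 2 ltac:(lra); have : 0 < Num.sqrt (2 : R) by rewrite sqrtr_gt0 ltr0n.
by set r := Num.sqrt 2 => r0; rewrite expr2 => r2; rewrite r0 andbT; apply/eqP; lra.
Qed.

Lemma spanning_vectors_mx M N :
  (forall i, spanning_vector i *m M = spanning_vector i *m N) -> M = N.
Proof.
move=> MN; have d0 : delta_mx 0 ord0 *m M = delta_mx 0 ord0 *m N :> V.
  by have := MN ord0; rewrite /spanning_vector eqxx.
apply/row_matrixP => i; rewrite !rowE.
have := MN i; rewrite /spanning_vector; case: eqVneq => [-> //|_].
by rewrite !mulmxDl -!scalemxAl d0 => /addrI.
Qed.

(** The matrix that agrees with g on the basis is determined by it.  Matching the
    basis together with one more point p yields the same matrix, which therefore
    agrees with g at p. *)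
Lemma isom_lorentz (g : isom (hyperbolic R n)) :
  exists2 M, lorentz M & forall p, (p : V) *m M = g p.
Proof.
pose basis : seq (hyperbolic R n) :=
  [seq Hyperbolic (spanning_vector_hyp i) | i <- enum 'I_n.+1].
have basisP i : Hyperbolic (spanning_vector_hyp i) \in basis.
  by apply/mapP; exists i; rewrite ?mem_enum.
have [M LM MP] := isom_lorentz_seq g basis.
exists M => // p; have [N _ NP] := isom_lorentz_seq g (p :: basis).
rewrite (_ : M = N); first by apply: NP; rewrite inE eqxx.
apply: spanning_vectors_mx => i.
have := MP _ (basisP i) => /= ->.
by have := NP (Hyperbolic (spanning_vector_hyp i)) => /= ->//; rewrite inE basisP orbT.
Qed.

End Lorentz.

(** * The action of Lorentz transformations on acausal functions *)

Section LinearCoordinates.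
Context {R : realType} {n : nat}.
Implicit Types (w z : 'rV[R]_n.+1) (t : R).

Lemma rV_headD w z : rV_head (w + z) = rV_head w + rV_head z.
Proof. by rewrite /rV_head mxE. Qed.

Lemma rV_headZ t w : rV_head (t *: w) = t * rV_head w.
Proof. by rewrite /rV_head mxE. Qed.

Lemma rV_tailD w z : rV_tail (w + z) = rV_tail w + rV_tail z.
Proof. by apply/rowP => i; rewrite !mxE. Qed.

Lemma rV_tailZ t w : rV_tail (t *: w) = t *: rV_tail w.
Proof. by apply/rowP => i; rewrite !mxE. Qed.

End LinearCoordinates.

Section Zero.
Context {R : realType}.

(** The zero is the supremum of the points where f is nonpositive. *)
Lemma bilipschitz_zero (f : R -> R) (k C : R) : 0 < k ->
  (forall s t, s <= t -> k * (t - s) <= f t - f s <= C * (t - s)) ->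
  exists s, f s = 0.
Proof.
move=> k0 fP.
have C0 : 0 < C by have /andP[] := fP 0 1 ltac:(lra); lra.
pose E := [set s | f s <= 0].
have fE : `|f 0| = k * (`|f 0| / k) by rewrite mulrC divfK// gt_eqF.
have q0 : 0 <= `|f 0| / k by rewrite divr_ge0// ltW.
have f0 := ler_norm (f 0); have f0' := ler_norm (- f 0); rewrite normrN in f0'.
have supE : has_sup E.
  split.
    exists (- (`|f 0| / k)); rewrite /E /=.
    by have /andP[+ _] := fP (- (`|f 0| / k)) 0 ltac:(lra); lra.
  exists (`|f 0| / k) => s; rewrite /E /= => fs; case: (leP s 0) => s0; first lra.
  have /andP[+ _] := fP 0 s (ltW s0).
  by move=> h; rewrite -(ler_pM2l k0) -fE; lra.
exists (sup E); case: (ltgtP (f (sup E)) 0) => // fs.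
  pose d := - f (sup E) / C.
  have d0 : 0 < d by rewrite divr_gt0//; lra.
  have dE : C * d = - f (sup E) by rewrite mulrC divfK// gt_eqF.
  have /andP[_ h] := fP (sup E) (sup E + d) ltac:(lra).
  have : E (sup E + d) by rewrite /E /=; nra.
  by move=> /(ub_le_sup supE.2); lra.
pose d := f (sup E) / C.
have d0 : 0 < d by rewrite divr_gt0//; lra.
have dE : C * d = f (sup E) by rewrite mulrC divfK// gt_eqF.
have : sup E <= sup E - d; last lra.
apply: ge_sup; first exact: supE.1.
move=> s; rewrite /E /= => fs0; case: (leP s (sup E - d)) => // hs.
have /andP[_ h1] := fP (sup E - d) (sup E) ltac:(lra).
have /andP[h2 _] := fP (sup E - d) s (ltW hs).
have : 0 < k * (s - (sup E - d)) by rewrite mulr_gt0// subr_gt0.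
by lra.
Qed.

End Zero.

Section Pull.
Context {R : realType} {n : nat}.
Local Notation V := 'rV[R]_n.+1.
Implicit Types (F G : 'rV[R]_n -> R) (M : 'M[R]_n.+1) (K : R).

Definition time_vector : V := rV_cons 1 0.

Lemma minkowski_time w : minkowski time_vector w = - rV_head w.
Proof.
rewrite minkowskiE /time_vector rV_cons0 rV_consK mul1r.
by rewrite -(scale0r 0) rV_dotZl mul0r sub0r.
Qed.

Lemma time_vector_hyp : on_hyperboloid time_vector.
Proof.
rewrite /on_hyperboloid minkowski_time -/(rV_head time_vector).
by rewrite /time_vector rV_cons0 eqxx ltr01.
Qed.

Lemma below_inj F G : (forall w, below F w = below G w) -> F = G.
Proof.
move=> FG; apply/funext => a; case: (ltgtP (F a) (G a)) => // h.
  by have := FG (rV_cons (F a) a); rewrite /below rV_cons0 rV_consK h ltxx.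
by have := FG (rV_cons (G a) a); rewrite /below rV_cons0 rV_consK h ltxx.
Qed.

(** The preimage under M of the graph of F is again a graph.  Along the vertical line over a,
    the image under M moves in the timelike direction xi, hence crosses the
    graph of F once, since F is 1-Lipschitz.  The new function inherits homogeneity
    from linearity, and the Lipschitz property from the invariance of the
    Minkowski form.  Its time coordinate is the product with the time vector, so
    a bound for the product of the points of the graph of F with xi is a slope
    bound for the new function. *)
Lemma acausal_pull M K F : lorentz M -> acausal_with K F ->
  exists F',
    (forall w, below F' w = below F (w *m M)) /\
    (forall K', (forall b, minkowski (time_vector *m M) (rV_cons (F b) b) ^+ 2 <=
            K' * minkowski (rV_cons (F b) b) (rV_cons (F b) b)) ->
          acausal_with K' F').
Proof.
move=> [Mi Mh _] aF; have [FZ lip _] := aF.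
pose xi := time_vector *m M.
pose p : hyperbolic R n := Hyperbolic (Mh _ time_vector_hyp).
have xi0 : 0 < rV_head xi := hyp_gt0 p.
have xixi : rV_dot (rV_tail xi) (rV_tail xi) = rV_head xi ^+ 2 - 1.
  by have := hyp_mink p; rewrite minkowskiE /= -/xi => /eqP; rewrite subr_eq => /eqP ->; ring.
have xt := rV_dot_ge0 (rV_tail xi).
(* xi is timelike: its spatial part has norm r smaller than its time part *)
pose r := Num.sqrt (rV_dot (rV_tail xi) (rV_tail xi)).
have r0 : 0 <= r := sqrtr_ge0 _.
have r2 : r ^+ 2 = rV_head xi ^+ 2 - 1 by rewrite sqr_sqrtr.
pose f a s := rV_head (rV_cons s a *m M) - F (rV_tail (rV_cons s a *m M)).
have fP a s t : s <= t ->
    (rV_head xi - r) * (t - s) <= f a t - f a s <= (rV_head xi + r) * (t - s).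
  move=> st; have zE : rV_cons t a *m M = rV_cons s a *m M + (t - s) *: xi.
    rewrite /xi scalemxAl -mulmxDl; congr (_ *m M).
    by rewrite /time_vector rV_consZ rV_consD mulr1 scaler0 addr0 addrC subrK.
  rewrite /f zE rV_headD rV_headZ rV_tailD rV_tailZ.
  set z := rV_cons s a *m M.
  have := lip (rV_tail z + (t - s) *: rV_tail xi) (rV_tail z).
  rewrite addrAC subrr add0r rV_dotZl rV_dotZr xixi -r2.
  have -> : (t - s) * ((t - s) * r ^+ 2) = ((t - s) * r) ^+ 2 by ring.
  move=> /sqr_le_normr; rewrite mulr_ge0 ?subr_ge0// => /(_ isT).
  by rewrite ler_norml => /andP[? ?]; apply/andP; split; lra.
have k0 : 0 < rV_head xi - r by nra.
have f_lt a s t : s < t -> f a s < f a t.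
  move=> st; have /andP[+ _] := fP a s t (ltW st).
  have : 0 < (rV_head xi - r) * (t - s) by rewrite mulr_gt0// subr_gt0.
  by lra.
have f_inj a s t : f a s = 0 -> f a t = 0 -> s = t.
  move=> fs ft; case: (ltgtP s t) => // /f_lt; move=> /(_ a); rewrite fs ft ltxx//.
have /choice[F' F'P] a : exists s, f a s = 0 by exact: bilipschitz_zero k0 (fP a).
have graph a : rV_head (rV_cons (F' a) a *m M) = F (rV_tail (rV_cons (F' a) a *m M)).
  by apply/eqP; rewrite -subr_eq0; apply/eqP; exact: F'P.
exists F'; split.
  move=> w; rewrite /below.
  have -> : (rV_head (w *m M) < F (rV_tail (w *m M))) = (f (rV_tail w) (rV_head w) < 0).
    by rewrite /f rV_eta subr_lt0.
  rewrite -(F'P (rV_tail w)); case: (ltgtP (rV_head w) (F' (rV_tail w))).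
  - by move/f_lt => ->.
  - by move/(f_lt (rV_tail w)) => /ltW; rewrite leNgt => /negbTE.
  - by move=> ->; rewrite ltxx.
move=> K' K'P; split.
- move=> t a; apply: (f_inj (t *: a)); first exact: F'P.
  rewrite /f -rV_consZ -scalemxAl rV_headZ rV_tailZ FZ -mulrBr.
  by rewrite -/(f a (F' a)) F'P mulr0.
- move=> a b; pose w := rV_cons (F' a) a - rV_cons (F' b) b.
  have wE : w = rV_cons (F' a - F' b) (a - b).
    by rewrite /w -scaleN1r rV_consZ rV_consD !scaleN1r mulN1r.
  have : 0 <= minkowski w w.
    rewrite -Mi /w mulmxBl minkowskiE -!(scaleN1r (_ *m M)).
    rewrite !(rV_tailD, rV_headD, rV_tailZ, rV_headZ) !graph !scaleN1r !mulN1r.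
    by rewrite subr_ge0 -expr2; exact: lip.
  by rewrite wE minkowskiE !rV_cons0 !rV_consK subr_ge0 -expr2.
- move=> a; pose w := rV_cons (F' a) a.
  have -> : rV_dot a a - F' a ^+ 2 = minkowski w w.
    by rewrite minkowskiE !rV_cons0 !rV_consK expr2.
  have -> : F' a = - minkowski time_vector w.
    by rewrite minkowski_time rV_cons0 opprK.
  rewrite sqrrN -(Mi time_vector) -(Mi w).
  have -> : w *m M = rV_cons (F (rV_tail (w *m M))) (rV_tail (w *m M)).
    by rewrite -[LHS]rV_eta graph.
  exact: K'P.
Qed.

(** A slope bound at the origin gives one at every point p. *)
Lemma acausal_pull_bound (p : hyperbolic R n) K F b : 0 <= K -> acausal_with K F ->
  minkowski p (rV_cons (F b) b) ^+ 2 <=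
  2 * rV_head p ^+ 2 * (1 + 2 * K) * minkowski (rV_cons (F b) b) (rV_cons (F b) b).
Proof.
move=> K0 [_ _ FK]; have := FK b.
have := rV_dot_CauchySchwarz (rV_tail p) b.
have := hyp_mink p; rewrite !minkowskiE !rV_cons0 !rV_consK.
have := rV_dot_ge0 b; have := rV_dot_ge0 (rV_tail p).
set x := rV_head p; set pp := rV_dot (rV_tail p) (rV_tail p); set bb := rV_dot b b.
set pb := rV_dot _ _; set y := F b => pp0 bb0 pE CS yK.
have ppE : pp = x ^+ 2 - 1 by rewrite expr2; lra.
have h1 : (pb - x * y) ^+ 2 <= 2 * pb ^+ 2 + 2 * (x * y) ^+ 2.
  by have := sqr_ge0 (pb + x * y); nra.
apply: (le_trans h1).
have h2 : pb ^+ 2 <= x ^+ 2 * bb by apply: (le_trans CS); rewrite ppE; nra.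
have h3 : 0 <= x ^+ 2 := sqr_ge0 _.
have h4 : bb + y ^+ 2 <= (1 + 2 * K) * (bb - y ^+ 2) by lra.
have h5 : x ^+ 2 * (bb + y ^+ 2) <= x ^+ 2 * ((1 + 2 * K) * (bb - y ^+ 2)).
  exact: ler_wpM2l.
by rewrite exprMn -(expr2 y); nra.
Qed.

End Pull.

(** * Points of hyperbolic space and the Crofton formula *)

Record acausal (R : realType) (n : nat) := Acausal {
  acausal_fun :> 'rV[R]_n -> R;
  acausalP : is_acausal acausal_fun }.

HB.instance Definition _ (R : realType) (n : nat) := [isSub for @acausal_fun R n].
HB.instance Definition _ (R : realType) (n : nat) := [Choice of acausal R n by <:].

Section Klein.
Context {R : realType} {n : nat}.
Implicit Types (p q : hyperbolic R n) (M : 'M[R]_n.+1).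

Lemma acausalW (F : acausal R n) : exists2 K, 0 <= K & acausal_with K F.
Proof. exact/asboolP/acausalP. Qed.

Lemma acausal_ext (F G : acausal R n) : (forall a, F a = G a) -> F = G.
Proof. by move=> FG; apply: val_inj; apply/funext. Qed.

(** A Lorentz transformation preserves the measure and the truncation, hence carries
    separating sets to separating sets of the same volume. *)
Lemma volume_between_pull M (F G F' G' : 'rV[R]_n -> R) : lorentz M ->
  is_acausal F -> is_acausal G ->
  (forall w, below F' w = below F (w *m M)) ->
  (forall w, below G' w = below G (w *m M)) ->
  volume_between F' G' = volume_between F G.
Proof.
move=> [Mi _ [_ Mm]] /asboolP[k k0 aF] /asboolP[k' k0' aG] FF' GG'.
have {}aF : acausal_with (k + k') F by apply: acausal_weaken aF; lra.
have {}aG : acausal_with (k + k') G by apply: acausal_weaken aG; lra.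
rewrite /volume_between -(Mm (separated F G)); last exact: measurable_separated aF aG.
congr (fine (rV_lebesgue _ _)).
by apply/seteqP; split=> w; rewrite /separated /= FF' GG' Mi.
Qed.

(** The spatial coordinates of p divided by its time coordinate are its coordinates
    in the Klein model, seen here as a linear form. *)
Definition klein_fun p (a : 'rV[R]_n) : R := rV_dot (rV_tail p) a / rV_head p.

Lemma below_klein p w : below (klein_fun p) w = (0 < minkowski p w).
Proof.
by rewrite /below /klein_fun ltr_pdivlMr ?hyp_gt0// minkowskiE subr_gt0 mulrC.
Qed.

Lemma klein_acausal p : is_acausal (klein_fun p).
Proof.
have h0 : 0 < rV_head p := hyp_gt0 p.
have pE : rV_dot (rV_tail p) (rV_tail p) = rV_head p ^+ 2 - 1.
  by have := hyp_mink p; rewrite minkowskiE expr2; lra.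
have h1 : 1 <= rV_head p ^+ 2 by have := rV_dot_ge0 (rV_tail p); lra.
have CS a : rV_head p ^+ 2 * klein_fun p a ^+ 2 <= (rV_head p ^+ 2 - 1) * rV_dot a a.
  rewrite -exprMn mulrC /klein_fun divfK ?gt_eqF// -pE.
  exact: rV_dot_CauchySchwarz.
apply/asboolP; exists (rV_head p ^+ 2 - 1); first by lra.
split=> [t a|a b|a].
- by rewrite /klein_fun rV_dotZr mulrA.
- have -> : klein_fun p a - klein_fun p b = klein_fun p (a - b).
    by rewrite /klein_fun rV_dotDr rV_dotNr mulrDl mulNr.
  by have := CS (a - b); have := rV_dot_ge0 (a - b); nra.
- by have := CS a; lra.
Qed.

Definition klein p : acausal R n := Acausal (klein_acausal p).

Lemma volume_klein_invariant p q p' q' : minkowski p q = minkowski p' q' ->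
  volume_between (klein p) (klein q) = volume_between (klein p') (klein q').
Proof.
move=> pq; have [|M LM MP] := @lorentz_matching _ _ [:: (p, p'); (q, q')].
  move=> x y; rewrite !inE => /orP[]/eqP-> /orP[]/eqP-> /=; rewrite ?hyp_mink//.
  by rewrite minkowskiC pq minkowskiC.
have [Mi _ _] := LM.
have Mp := MP (p, p') ltac:(by rewrite !inE eqxx).
have Mq := MP (q, q') ltac:(by rewrite !inE eqxx orbT).
apply: (volume_between_pull LM); rewrite ?klein_acausal// => w.
- by rewrite !below_klein -Mp Mi.
- by rewrite !below_klein -Mq Mi.
Qed.

End Klein.

Section AdditiveFunctions.
Context {R : realType}.

(** Monotonicity squeezes f (k * t) = k * f t between the values of f at two
    consecutive integers. *)
Lemma additive_nonneg_linear (f : R -> R) : (forall t, 0 <= t -> 0 <= f t) ->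
  (forall s t, 0 <= s -> 0 <= t -> f (s + t) = f s + f t) ->
  forall t, 0 <= t -> f t = t * f 1.
Proof.
move=> f_ge0 fD; have fn k t : 0 <= t -> f (k%:R * t) = k%:R * f t.
  move=> t0; elim: k => [|k IHk].
    by have := fD 0 0 (lexx _) (lexx _); rewrite !mul0r addr0; lra.
  by rewrite -natr1 !mulrDl !mul1r fD ?IHk// mulr_ge0.
have f_le s t : 0 <= s -> s <= t -> f s <= f t.
  move=> s0 st; have := fD s (t - s) s0 ltac:(lra); rewrite addrC subrK => ->.
  by rewrite lerDl f_ge0// subr_ge0.
move=> t t0; apply/eqP; rewrite -subr_eq0 -normr_eq0; apply/eqP.
have bound k : k%:R * `|f t - t * f 1| <= f 1.
  have kt0 : 0 <= k%:R * t by rewrite mulr_ge0.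
  have /andP[m1 m2] := truncn_itv kt0; set m := Num.truncn _ in m1 m2.
  have m0 : (0 : R) <= m%:R := ler0n _ _.
  have := f_le _ _ m0 m1; have := f_le _ _ kt0 (ltW m2).
  rewrite fn// -[in f m%:R](mulr1 m%:R) -[in f m.+1%:R](mulr1 m.+1%:R) !fn//.
  have := f_ge0 1 ler01; rewrite -natr1 in m2 *; set c := f 1 => c0 h1 h2.
  rewrite -[X in X * _](ger0_norm (ler0n R k)) -normrM ler_norml.
  by apply/andP; split; nra.
apply/eqP; rewrite eq_le normr_ge0 andbT leNgt; apply/negP => d0.
have := archi_boundP (divr_ge0 (f_ge0 1 ler01) (ltW d0)).
rewrite ltr_pdivrMr//; set k := Num.bound _ => h.
by have := bound k; lra.
Qed.

End AdditiveFunctions.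

Section Crofton.
Context {R : realType} {m : nat}.

Definition cosh (t : R) : R := (expR t + expR (- t)) / 2.
Definition sinh (t : R) : R := (expR t - expR (- t)) / 2.

Lemma cosh_gt0 t : 0 < cosh t.
Proof. by have := expR_gt0 t; have := expR_gt0 (- t); rewrite /cosh; lra. Qed.

Lemma sinh_ge0 t : 0 <= t -> 0 <= sinh t.
Proof.
move=> t0; have : expR (- t) <= expR t by rewrite ler_expR; lra.
by rewrite /sinh; lra.
Qed.

Lemma coshB s t : cosh (t - s) = cosh s * cosh t - sinh s * sinh t.
Proof. by rewrite /cosh /sinh opprB !expRD; field. Qed.

Lemma sinhB s t : sinh (t - s) = sinh t * cosh s - sinh s * cosh t.
Proof. by rewrite /cosh /sinh opprB !expRD; field. Qed.

Lemma cosh_arcosh u : 1 <= u -> cosh (arcosh u) = u.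
Proof.
move=> u1; rewrite /cosh expRN /arcosh lnK; last first.
  by rewrite posrE; have := arcosh_arg_ge1 u1; lra.
have := arcosh_arg_ge1 u1; have := @sqr_sqrtr _ (u ^+ 2 - 1) ltac:(nra).
set s := Num.sqrt _ => s2 us1.
have -> : (u + s)^-1 = u - s.
  have us0 : u + s != 0 by rewrite gt_eqF//; lra.
  apply: (mulfI us0); rewrite divff//.
  have -> : (u + s) * (u - s) = u ^+ 2 - s ^+ 2 by ring.
  by rewrite s2; ring.
by lra.
Qed.

Lemma arcosh_ge0 (u : R) : 1 <= u -> 0 <= arcosh u.
Proof. by move=> u1; rewrite /arcosh ln_ge0// arcosh_arg_ge1. Qed.

(** The unit speed geodesic through the origin in the first spatial direction. *)
Definition boost_row (t : R) : 'rV[R]_m.+2 :=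
  rV_cons (cosh t) (sinh t *: delta_mx 0 ord0).

Lemma rV_dot_delta (a : 'rV[R]_m.+1) i : rV_dot (delta_mx 0 i) a = a 0 i.
Proof.
rewrite /rV_dot (bigD1 i)//= mxE !eqxx mul1r big1 ?addr0// => j ji.
by rewrite mxE eqxx (negbTE ji) mul0r.
Qed.

Lemma minkowski_boost_row s t :
  minkowski (boost_row s) (boost_row t) = - cosh (t - s).
Proof.
rewrite minkowskiE /boost_row !rV_cons0 !rV_consK rV_dotZl rV_dotZr rV_dot_delta.
by rewrite mxE !eqxx mulr1 coshB; ring.
Qed.

Lemma boost_row_hyp t : on_hyperboloid (boost_row t).
Proof.
rewrite /on_hyperboloid minkowski_boost_row subrr /cosh oppr0 expR0.
rewrite -/(rV_head _) rV_cons0 cosh_gt0 andbT; apply/eqP; lra.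
Qed.

Definition boost t : hyperbolic R m.+1 := Hyperbolic (boost_row_hyp t).

Lemma klein_boost t a : klein (boost t) a = sinh t / cosh t * a 0 ord0.
Proof.
rewrite /= /klein_fun /= /boost_row rV_cons0 rV_consK rV_dotZl rV_dot_delta.
by rewrite mulrAC.
Qed.

Lemma tanh_le s t : s <= t -> sinh s / cosh s <= sinh t / cosh t.
Proof.
move=> st; rewrite ler_pdivrMr ?cosh_gt0// mulrAC ler_pdivlMr ?cosh_gt0//.
by rewrite -subr_ge0 -sinhB sinh_ge0// subr_ge0.
Qed.

Definition boost_volume t : R := volume_between (klein (boost 0)) (klein (boost t)).

(** The invariant volume is proportional to hyperbolic length; this is the volume
    of a unit segment. *)
Definition crofton : R := boost_volume 1.

Lemma boost_volume_ge0 t : 0 <= boost_volume t.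
Proof. by rewrite /boost_volume /volume_between fine_ge0// measure_ge0. Qed.

(** Points of a geodesic have linear forms proportional to one another, so the
    middle one is pointwise between the others. *)
Lemma boost_volumeD s t : 0 <= s -> 0 <= t ->
  boost_volume (s + t) = boost_volume s + boost_volume t.
Proof.
move=> s0 t0.
have btw a : between (klein (boost 0) a) (klein (boost s) a) (klein (boost (s + t)) a).
  rewrite !klein_boost.
  have sinh0 : sinh 0 = 0 by rewrite /sinh oppr0 subrr mul0r.
  have := tanh_le s0; have := @tanh_le s (s + t) ltac:(lra).
  rewrite sinh0 !mul0r /between; set x := sinh s / _; set y := sinh _ / _ => xy x0.
  case: (leP 0 (a 0 ord0)) => a0; apply/orP; [left|right]; apply/andP; split; nra.
have E : boost_volume (s + t) =
    boost_volume s + volume_between (klein (boost s)) (klein (boost (s + t))).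
  rewrite /boost_volume.
  exact: (volume_between_additive (acausalP (klein (boost 0)))
    (acausalP (klein (boost s))) (acausalP (klein (boost (s + t)))) btw).
have tE : volume_between (klein (boost s)) (klein (boost (s + t))) = boost_volume t.
  apply: volume_klein_invariant.
  rewrite -[LHS]/(minkowski (boost_row s) (boost_row (s + t))).
  rewrite -[RHS]/(minkowski (boost_row 0) (boost_row t)).
  by rewrite !minkowski_boost_row; congr (- cosh _); ring.
exact: (etrans E (congr1 (fun x => boost_volume s + x) tE)).
Qed.

Theorem crofton_formula (p q : hyperbolic R m.+1) :
  volume_between (klein p) (klein q) = mdist p q * crofton.
Proof.
rewrite hyp_mdistE; have u1 := hyp_ge1 p q; set u := arcosh _.
have bE : boost_volume u = u * boost_volume 1.
  by apply: (additive_nonneg_linear (fun t _ => boost_volume_ge0 t) boost_volumeD);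
    exact: arcosh_ge0.
rewrite /crofton -bE /boost_volume; apply: volume_klein_invariant.
rewrite -[RHS]/(minkowski (boost_row 0) (boost_row u)).
by rewrite minkowski_boost_row subr0 cosh_arcosh// opprK.
Qed.

Lemma crofton_gt0 : 0 < crofton.
Proof.
rewrite lt_neqAle boost_volume_ge0 andbT eq_sym; apply/eqP => c0.
have := volume_between_eq0 (acausalP _) (acausalP _) c0.
move=> /(congr1 (fun F => F (delta_mx 0 ord0))).
rewrite -[LHS]/(klein (boost 0) _) -[RHS]/(klein (boost 1) _) !klein_boost mxE !eqxx.
rewrite /sinh oppr0 subrr !mul0r mulr1 => /esym/eqP.
rewrite !mulf_eq0 !invr_eq0 (gt_eqF (cosh_gt0 1)) pnatr_eq0 !orbF subr_eq0.
by move=> /eqP/expR_inj; lra.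
Qed.

End Crofton.

(** * The median metric and the isometric action *)

Section MedianReal.
Context {R : realType}.
Implicit Types x y z m d t : R.

Definition med3 x y z : R := Num.max (Num.min x y) (Num.min (Num.max x y) z).

Lemma between_med3 x y z :
  [/\ between x (med3 x y z) y, between y (med3 x y z) z & between x (med3 x y z) z].
Proof.
by rewrite /between /med3 !minEle !maxEle; do !case: ifPn; rewrite -?ltNge => *;
  split; apply/orP; (try by left; apply/andP; split; lra);
  by right; apply/andP; split; lra.
Qed.

(** A gap between two candidates would have two of the three points on one side. *)
Lemma between_unique x y z m m' :
  between x m y -> between y m z -> between x m z ->
  between x m' y -> between y m' z -> between x m' z -> m = m'.
Proof.
have sides (u v p q : R) : p < q -> between u p v -> between u q v ->
    (u <= p /\ q <= v) \/ (v <= p /\ q <= u).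
  by move=> pq /orP[]/andP[? ?] /orP[]/andP[? ?]; (left; split; lra) || (right; split; lra).
have no_gap (p q : R) : p < q -> between x p y -> between y p z -> between x p z ->
    between x q y -> between y q z -> between x q z -> False.
  move=> pq xpy ypz xpz xqy yqz xqz; move: (sides _ _ _ _ pq xpy xqy).
  move: (sides _ _ _ _ pq ypz yqz) (sides _ _ _ _ pq xpz xqz) => {xpy ypz xpz xqy yqz xqz}.
  by case=> -[? ?] [] [? ?] [] [? ?]; lra.
move=> b1 b2 b3 c1 c2 c3; case: (ltgtP m m') => // mm'.
  by case: (no_gap _ _ mm' b1 b2 b3 c1 c2 c3).
by case: (no_gap _ _ mm' c1 c2 c3 b1 b2 b3).
Qed.

Lemma between_scale t x m y : between x m y -> between (t * x) (t * m) (t * y).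
Proof.
case: (leP 0 t) => t0 /orP[] /andP[? ?]; apply/orP.
- by left; apply/andP; split; nra.
- by right; apply/andP; split; nra.
- by right; apply/andP; split; nra.
- by left; apply/andP; split; nra.
Qed.

Lemma med3_scale t x y z : med3 (t * x) (t * y) (t * z) = t * med3 x y z.
Proof.
have [b1 b2 b3] := between_med3 x y z.
have [c1 c2 c3] := between_med3 (t * x) (t * y) (t * z).
by apply: between_unique c1 c2 c3 _ _ _; exact: between_scale.
Qed.

Lemma maxr_lipschitz d x y x' y' : `|x - x'| <= d -> `|y - y'| <= d ->
  `|Num.max x y - Num.max x' y'| <= d.
Proof.
rewrite !ler_norml !maxEle => /andP[? ?] /andP[? ?].
by do 2 case: ifPn; rewrite -?ltNge => *; apply/andP; split; lra.
Qed.

Lemma minr_lipschitz d x y x' y' : `|x - x'| <= d -> `|y - y'| <= d ->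
  `|Num.min x y - Num.min x' y'| <= d.
Proof.
rewrite !ler_norml !minEle => /andP[? ?] /andP[? ?].
by do 2 case: ifPn; rewrite -?ltNge => *; apply/andP; split; lra.
Qed.

Lemma med3_cases x y z : [\/ med3 x y z = x, med3 x y z = y | med3 x y z = z].
Proof.
by rewrite /med3 !minEle !maxEle; do !case: ifPn => _;
  (by constructor 1) || (by constructor 2) || by constructor 3.
Qed.

End MedianReal.

Section MedianAcausal.
Context {R : realType} {n : nat}.
Implicit Types F G H : acausal R n.

Lemma med3_acausal F G H : is_acausal (fun a => med3 (F a) (G a) (H a)).
Proof.
have [k k0 aF] := acausalW F; have [k' k0' aG] := acausalW G.
have [k'' k0'' aH] := acausalW H.
pose K := k + k' + k''.
have {}aF : acausal_with K F by apply: acausal_weaken aF; rewrite /K; lra.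
have {}aG : acausal_with K G by apply: acausal_weaken aG; rewrite /K; lra.
have {}aH : acausal_with K H by apply: acausal_weaken aH; rewrite /K; lra.
have [FZ Fl FK] := aF; have [GZ Gl GK] := aG; have [HZ Hl HK] := aH.
apply/asboolP; exists K; first by rewrite /K; lra.
split=> [t a|a b|a].
- by rewrite FZ GZ HZ med3_scale.
- have d0 := rV_dot_ge0 (a - b).
  have norm_le x : x ^+ 2 <= rV_dot (a - b) (a - b) -> `|x| <= Num.sqrt (rV_dot (a - b) (a - b)).
    by move=> xd; apply: sqr_le_normr; rewrite ?sqrtr_ge0// sqr_sqrtr.
  have /norm_le Fd := Fl a b; have /norm_le Gd := Gl a b; have /norm_le Hd := Hl a b.
  rewrite -real_normK ?num_real// -[leRHS]sqr_sqrtr// ler_pXn2r ?nnegrE ?sqrtr_ge0//.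
  apply: maxr_lipschitz; first exact: minr_lipschitz.
  by apply: minr_lipschitz => //; exact: maxr_lipschitz.
- by case: (med3_cases (F a) (G a) (H a)) => ->.
Qed.

Definition median_acausal F G H : acausal R n := Acausal (med3_acausal F G H).

(** Let m be the pointwise median of F, G and H.  It lies between any two of them,
    so the three volumes split at m, and the equality forces the volume between m
    and G to vanish. *)
Lemma volume_between_eq_between F G H :
  volume_between F G + volume_between G H = volume_between F H ->
  forall a, between (F a) (G a) (H a).
Proof.
move=> FGH a; pose m := median_acausal F G H.
have mP b := between_med3 (F b) (G b) (H b).
have e1 : volume_between F G = volume_between F m + volume_between m G.
  by apply: volume_between_additive; rewrite ?acausalP// => b; have [] := mP b.
have e2 : volume_between G H = volume_between G m + volume_between m H.
  by apply: volume_between_additive; rewrite ?acausalP// => b; have [] := mP b.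
have e3 : volume_between F H = volume_between F m + volume_between m H.
  by apply: volume_between_additive; rewrite ?acausalP// => b; have [] := mP b.
have mG : volume_between m G = 0.
  move: FGH; rewrite e1 e2 e3 (volume_betweenC G m).
  by move: (volume_between F m) (volume_between m H) (volume_between m G) => u v w; clear; lra.
have := volume_between_eq0 (acausalP m) (acausalP G) mG.
by move=> /(congr1 (fun f => f a)) <- /=; have [] := mP a.
Qed.

End MedianAcausal.

Section AcausalMetric.
Context {R : realType} {m : nat}.
Local Notation M := (acausal R m.+1).
Implicit Types F G H : M.
Local Notation c := (@crofton R m).

Definition acausal_dist F G : R := volume_between F G / c.

Let crofton_unit : c != 0.
Proof. exact: lt0r_neq0 crofton_gt0. Qed.

Let acausal_distxx F : acausal_dist F F = 0.
Proof. by rewrite /acausal_dist volume_betweenxx mul0r. Qed.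

Let acausal_dist_positivity F G : acausal_dist F G = 0 -> F = G.
Proof.
move/eqP; rewrite mulf_eq0 => /orP[/eqP v0|]; last first.
  by rewrite invr_eq0 (negbTE crofton_unit).
by apply: val_inj; apply: volume_between_eq0 => //; exact: acausalP.
Qed.

Let acausal_dist_sym F G : acausal_dist F G = acausal_dist G F.
Proof. by rewrite /acausal_dist volume_betweenC. Qed.

Let acausal_dist_triangle G F H :
  acausal_dist F H <= acausal_dist F G + acausal_dist G H.
Proof.
rewrite /acausal_dist -mulrDl ler_pM2r ?invr_gt0 ?crofton_gt0//.
by apply: volume_between_triangle; exact: acausalP.
Qed.

HB.instance Definition _ := isMetric.Build R M
  acausal_distxx acausal_dist_positivity acausal_dist_sym acausal_dist_triangle.

Lemma acausal_mdistE F G : mdist F G = volume_between F G / c.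
Proof. exact: erefl. Qed.

Lemma klein_isometric : isometric (@klein R m.+1).
Proof.
move=> p q; have -> : mdist (klein p) (klein q) = volume_between (klein p) (klein q) / c.
  exact: acausal_mdistE.
idtac.
have E := crofton_formula p q.
rewrite E.
exact: (mulfK crofton_unit).
Qed.

Lemma acausal_median_space : @median_space R M.
Proof.
move=> x; pose i0 : 'I_3 := ord0; pose i1 : 'I_3 := lift ord0 ord0; pose i2 : 'I_3 := ord_max.
have mdist_btw (F G H : M) : (forall a, between (F a) (G a) (H a)) ->
    mdist F G + mdist G H = mdist F H.
  move=> b; rewrite !acausal_mdistE -mulrDl; congr (_ / _).
  by apply/esym/volume_between_additive => //; exact: acausalP.
have btw_mdist (F G H : M) : mdist F G + mdist G H = mdist F H ->
    forall a, between (F a) (G a) (H a).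
  rewrite !acausal_mdistE -mulrDl => /(mulIf _) h; apply: volume_between_eq_between.
  by apply: h; rewrite invr_eq0.
have ord3 (i : 'I_3) : [\/ i = i0, i = i1 | i = i2].
  by case: i => [[|[|[|//]]] ?]; [constructor 1|constructor 2|constructor 3]; apply/val_inj.
have btwC (a b d : R) : between a b d -> between d b a by rewrite /between orbC.
exists (median_acausal (x i0) (x i1) (x i2)); split.
  move=> i j ij; apply: mdist_btw => a.
  have [b1 b2 b3] := between_med3 (x i0 a) (x i1 a) (x i2 a).
  by move: ij; case: (ord3 i) => ->; case: (ord3 j) => -> // _;
    rewrite ?eqxx//=;
    (exact: b1 || exact: b2 || exact: b3 ||
     (apply: btwC; (exact: b1 || exact: b2 || exact: b3))).
move=> m' m'P; apply: acausal_ext => a /=.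
have [b1 b2 b3] := between_med3 (x i0 a) (x i1 a) (x i2 a).
by apply: between_unique b1 b2 b3 _ _ _; apply: btw_mdist; exact: m'P.
Qed.

End AcausalMetric.

Section Action.
Context {R : realType} {m : nat}.
Local Notation M := (acausal R m.+1).
Local Notation G := (isom (hyperbolic R m.+1)).
Implicit Types (F : M) (g h : G) (p : hyperbolic R m.+1).

Definition isom_mx g : 'M[R]_m.+2 := s2val (cid2 (isom_lorentz g)).

Lemma isom_mx_lorentz g : lorentz (isom_mx g).
Proof. by rewrite /isom_mx; case: cid2. Qed.

Lemma mulmx_isom_mx g p : (p : 'rV[R]_m.+2) *m isom_mx g = g p.
Proof. by rewrite /isom_mx; case: cid2 => ? ? /= ->. Qed.

Lemma isom_mx_unique g A : (forall p, (p : 'rV[R]_m.+2) *m A = g p) -> isom_mx g = A.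
Proof.
move=> gA; apply: spanning_vectors_mx => i.
pose p := Hyperbolic (spanning_vector_hyp (R := R) i).
by have := mulmx_isom_mx g p; rewrite -(gA p).
Qed.

Lemma isom_mx1 : isom_mx 1%g = 1%:M.
Proof. by apply: isom_mx_unique => p; rewrite mulmx1. Qed.

Lemma isom_mxM g h : isom_mx (g * h)%g = isom_mx h *m isom_mx g.
Proof. by apply: isom_mx_unique => p; rewrite mulmxA !mulmx_isom_mx. Qed.

Lemma acausal_act_exists g F :
  exists F' : M, forall w, below F' w = below F (w *m isom_mx g^-1%g).
Proof.
have [K K0 aF] := acausalW F; have LM := isom_mx_lorentz g^-1%g.
have [F' [F'b F'K]] := acausal_pull LM aF; have [_ Mh _] := LM.
suff F'a : is_acausal F' by exists (Acausal F'a).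
pose p := Hyperbolic (Mh _ time_vector_hyp).
apply/asboolP; exists (2 * rV_head p ^+ 2 * (1 + 2 * K)).
  by apply: mulr_ge0; [have := sqr_ge0 (rV_head p)|]; lra.
by apply: F'K => b; exact: (acausal_pull_bound p).
Qed.

(** The half-spaces below the image of F by g are the images by g of the half-spaces
    below F. *)
Definition acausal_act g F : M := sval (cid (acausal_act_exists g F)).

Lemma below_act g F w :
  below (acausal_act g F) w = below F (w *m isom_mx g^-1%g).
Proof. by rewrite /acausal_act; case: cid. Qed.

Lemma acausal_act_isometric_action : isometric_action acausal_act.
Proof.
split=> [F|g h F|g F H].
- by apply/val_inj/below_inj => w; rewrite below_act invg1 isom_mx1 mulmx1.
- by apply/val_inj/below_inj => w; rewrite !below_act invgM isom_mxM mulmxA.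
have volE : volume_between (acausal_act g F) (acausal_act g H) = volume_between F H.
  by apply: (volume_between_pull (isom_mx_lorentz g^-1%g));
    [exact: acausalP|exact: acausalP|exact: below_act|exact: below_act].
exact: (congr1 (fun v => v / crofton) volE).
Qed.

Lemma klein_equivariant g p : klein (g p) = acausal_act g (klein p).
Proof.
apply/val_inj/below_inj => w; rewrite below_act !below_klein.
have [Mi _ _] := isom_mx_lorentz g^-1%g.
have <- : (g p : 'rV[R]_m.+2) *m isom_mx g^-1%g = p.
  by rewrite mulmx_isom_mx -isomME mulVg.
by rewrite Mi.
Qed.

End Action.

(** * Finite Hausdorff distance *)

Section Cobounded.
Context {R : realType}.

Lemma discriminant_le (A X C : R) : 0 <= C ->
  (forall t, 0 <= A - 2 * t * X + t ^+ 2 * C) -> X ^+ 2 <= A * C.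
Proof.
move=> C0 tP; have [C00|Cn0] := eqVneq C 0.
  rewrite C00 mulr0; have [->|X0] := eqVneq X 0; first by rewrite expr0n.
  have := tP ((A + 1) / (2 * X)); rewrite C00 mulr0 addr0.
  have -> : A - 2 * ((A + 1) / (2 * X)) * X = -1 by field.
  by rewrite ler0N1.
have Cp : 0 < C by rewrite lt_neqAle eq_sym Cn0.
have := tP (X / C).
have -> : A - 2 * (X / C) * X + (X / C) ^+ 2 * C = (A * C - X ^+ 2) / C by field.
by rewrite pmulr_lge0 ?invr_gt0// subr_ge0.
Qed.

Context {m : nat}.
Local Notation M := (acausal R m.+1).

(** The vectors of the plane spanned by two points of the graph of F have
    nonnegative Minkowski square, since differences of points of the graph do. *)
Lemma acausal_CauchySchwarz n K (F : 'rV[R]_n -> R) u b : acausal_with K F ->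
  (rV_dot u b - F u * F b) ^+ 2 <=
  (rV_dot u u - F u ^+ 2) * (rV_dot b b - F b ^+ 2).
Proof.
move=> aF; have [FZ lip _] := aF; apply: discriminant_le.
  by rewrite subr_ge0; exact: acausal_spacelike aF.
move=> t; have := lip u (t *: b); rewrite FZ -subr_ge0.
rewrite !(rV_dotDl, rV_dotDr, rV_dotNl, rV_dotNr, rV_dotZl, rV_dotZr) (rV_dotC b u).
by congr (0 <= _); ring.
Qed.

(** Here s is the square of the supremum of the slopes of F.  The supremum need not be
    shown to be attained: a slope at which 1 - s at most doubles is enough below. *)
Lemma acausal_sup_slope K (F : 'rV[R]_m.+1 -> R) : 0 <= K -> acausal_with K F ->
  exists s : R, exists2 u, [/\ 0 <= s < 1, forall a, F a ^+ 2 <= s * rV_dot a a &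
    rV_dot u u = 1] & 1 - F u ^+ 2 <= 2 * (1 - s).
Proof.
move=> K0 aF; have [FZ _ FK] := aF.
pose E := [set k : R | forall a, F a ^+ 2 <= k * rV_dot a a].
pose e0 : 'rV[R]_m.+1 := delta_mx 0 ord0.
have e01 : rV_dot e0 e0 = 1 by rewrite rV_dot_delta mxE !eqxx.
have EK : E (K / (1 + K)).
  move=> a; have := FK a; have K1 : 0 < 1 + K by lra.
  by rewrite mulrAC ler_pdivlMr//; lra.
have lb0 : lbound E 0.
  by move=> k Ek; have := Ek e0; rewrite e01 mulr1; apply: le_trans; exact: sqr_ge0.
have infE : has_inf E by split; [exists (K / (1 + K))|exists 0].
pose s := inf E.
have s0 : 0 <= s by apply: lb_le_inf => //; exact: infE.1.
have s1 : s < 1.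
  apply: (@le_lt_trans _ _ (K / (1 + K))); first exact: ge_inf infE.2 _ EK.
  by rewrite ltr_pdivrMr; lra.
have Es : E s.
  move=> a; have := rV_dot_ge0 a; rewrite le_eqVlt => /orP[/eqP a0|a0].
    by have := acausal_spacelike a aF; rewrite -a0 mulr0.
  rewrite -ler_pdivrMr//; apply: lb_le_inf; first exact: infE.1.
  by move=> k Ek; rewrite ler_pdivrMr//; exact: Ek.
(* 1 - (2 * s - 1) is twice 1 - s *)
have nE : ~ E (2 * s - 1) by move=> /(ge_inf infE.2); rewrite -/s; lra.
have [a Fa] : exists a, (2 * s - 1) * rV_dot a a < F a ^+ 2.
  by apply: contrapT => /forallNP h; apply: nE => a; rewrite leNgt; apply/negP/h.
have a0 : 0 < rV_dot a a.
  rewrite lt_neqAle rV_dot_ge0 andbT; apply/eqP => a0; move: Fa.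
  by rewrite -a0 mulr0 ltNge; have := acausal_spacelike a aF; rewrite -a0 => ->.
pose r := (Num.sqrt (rV_dot a a))^-1.
have r2 : r ^+ 2 * rV_dot a a = 1.
  by rewrite exprVn sqr_sqrtr ?ltW// mulVf// gt_eqF.
exists s, (r *: a).
  by split=> //; [rewrite s0 s1|rewrite rV_dotZl rV_dotZr mulrA -expr2].
rewrite FZ exprMn.
have : r ^+ 2 * ((2 * s - 1) * rV_dot a a) <= r ^+ 2 * F a ^+ 2.
  by rewrite ler_wpM2l ?sqr_ge0// ltW.
by rewrite mulrCA r2; lra.
Qed.

(** The point p lies on the ray of u, at slope F u.  The left side is the squared sinh of
    the distance from p to the hyperplane orthogonal to a vector of the graph of F,
    times the Minkowski square of this vector.  The estimate combines
    [acausal_CauchySchwarz] at u with the near maximality of the slope of F at u. *)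
Lemma acausal_bounded_position (F : M) :
  exists p : hyperbolic R m.+1, forall b,
    minkowski p (rV_cons (F b) b) ^+ 2 <=
    6 * minkowski (rV_cons (F b) b) (rV_cons (F b) b).
Proof.
have [K K0 aF] := acausalW F.
have [s [u [/andP[s0 s1] Fs u1] us]] := acausal_sup_slope K0 aF.
pose y := F u; have y1 : 0 < 1 - y ^+ 2.
  by have := Fs u; rewrite u1 -/y; lra.
(* the factor r puts (1, y *: u) on the hyperboloid *)
pose r := (Num.sqrt (1 - y ^+ 2))^-1.
have r0 : 0 < r by rewrite invr_gt0 sqrtr_gt0.
have r2 : r ^+ 2 * (1 - y ^+ 2) = 1.
  by rewrite exprVn sqr_sqrtr ?ltW// mulVf// gt_eqF.
have pH : on_hyperboloid (r *: rV_cons 1 (y *: u)).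
  apply/andP; split; last by rewrite -/(rV_head _) rV_headZ rV_cons0 mulr1.
  apply/eqP; rewrite minkowskiZl minkowskiZr minkowskiE !rV_cons0 !rV_consK.
  by rewrite rV_dotZl rV_dotZr u1; lra.
exists (Hyperbolic pH) => b /=.
rewrite minkowskiZl exprMn !minkowskiE !rV_cons0 !rV_consK rV_dotZl mul1r -(expr2 (F b)).
have := acausal_CauchySchwarz u b aF; rewrite u1 -/y.
have := Fs b; have := rV_dot_ge0 b; rewrite -/y in us.
set B := rV_dot b b; set x := rV_dot u b; set f := F b => B0 fs CS.
have Q0 : (1 - s) * B <= B - f ^+ 2 by lra.
have h1 : (1 - y ^+ 2) * f ^+ 2 <= 2 * (B - f ^+ 2).
  have f2 : f ^+ 2 <= B by nra.
  have : (1 - y ^+ 2) * f ^+ 2 <= 2 * (1 - s) * B.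
    by apply: ler_pM; rewrite ?sqr_ge0//; exact: ltW.
  by lra.
have h2 : (y * x - f) ^+ 2 <=
    2 * (y ^+ 2 * (x - y * f) ^+ 2) + 2 * ((1 - y ^+ 2) ^+ 2 * f ^+ 2).
  have -> : y * x - f = y * (x - y * f) - (1 - y ^+ 2) * f by ring.
  rewrite -!exprMn; set P := y * _; set Q := _ * f.
  by have := sqr_ge0 (P + Q); lra.
have h3 : y ^+ 2 * (x - y * f) ^+ 2 <= (1 - y ^+ 2) * (B - f ^+ 2).
  apply: le_trans CS; rewrite -[leRHS]mul1r ler_wpM2r ?sqr_ge0//; lra.
have h4 : (1 - y ^+ 2) ^+ 2 * f ^+ 2 <= (1 - y ^+ 2) * (2 * (B - f ^+ 2)).
  by rewrite expr2 -mulrA ler_wpM2l// ltW.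
have h5 : (y * x - f) ^+ 2 <= (1 - y ^+ 2) * (6 * (B - f ^+ 2)) by lra.
apply: (@le_trans _ _ (r ^+ 2 * ((1 - y ^+ 2) * (6 * (B - f ^+ 2))))).
  by rewrite ler_wpM2l ?sqr_ge0.
by rewrite mulrA r2 mul1r.
Qed.

Definition time_point : hyperbolic R m.+1 := Hyperbolic time_vector_hyp.

Lemma klein_time_acausal K : 0 <= K -> acausal_with K (klein time_point).
Proof.
move=> K0.
have k0 a : klein time_point a = 0.
  rewrite /= /klein_fun /= /time_vector rV_consK -(scale0r 0) rV_dotZl.
  by rewrite mul0r mul0r.
split=> [t a|a b|a]; rewrite !k0 ?mulr0// ?subrr ?expr0n /= ?rV_dot_ge0//.
by rewrite subr0 mulr_ge0// rV_dot_ge0.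
Qed.

(** Moving the point of [acausal_bounded_position] to the origin turns its estimate
    into a universal slope bound. *)
Lemma acausal_cobounded :
  exists2 C : R, 0 < C & forall F : M, exists p, mdist F (klein p) < C.
Proof.
pose B : R := 2 * (6 + 2) * (2 * (6 + 2)) ^+ m.+1.
pose c := @crofton R m; have c0 : 0 < c := crofton_gt0.
exists (B / c + 1).
  by rewrite ltr_wpDl ?divr_ge0 ?ltW// /B mulr_gt0 ?exprn_gt0//; lra.
move=> F; have [p pP] := acausal_bounded_position F.
have [K K0 aF] := acausalW F.
have [|A LA AP] := @lorentz_matching _ _ [:: (time_point, p)].
  move=> x y; rewrite !inE => /eqP -> /eqP ->.
  by rewrite [LHS](hyp_mink time_point) [RHS](hyp_mink p).
have Ap : (time_vector : 'rV[R]_m.+2) *m A = p.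
  by apply: (AP (time_point, p)); rewrite inE eqxx.
have [Ai _ _] := LA.
have [F' [F'b F'K]] := acausal_pull LA aF.
have aF' : acausal_with 6 F' by apply: F'K => b; rewrite Ap; exact: pP.
exists p.
have volE : volume_between F' (klein time_point) = volume_between F (klein p).
  apply: (volume_between_pull LA) => //; [exact: acausalP|exact: acausalP|].
  by move=> w; rewrite !below_klein -[in RHS]Ap Ai.
have volB : volume_between F (klein p) <= B.
  have k60 : (0 : R) <= 6 := ler0n _ _.
  rewrite -volE; exact: (volume_between_bounded k60 aF' (klein_time_acausal k60)).
have E := acausal_mdistE F (klein p).
apply: (@le_lt_trans _ _ (B / c)); last by rewrite ltrDl.
by rewrite E ler_pM2r ?invr_gt0.
Qed.

Lemma hausdorff_klein :
  (hausdorff_dist [set: M] (range (@klein R m.+1)) < +oo)%E.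
Proof.
have [C C0 CP] := acausal_cobounded.
apply: (@le_lt_trans _ _ C%:E); last exact: ltry.
apply: ereal_inf_lbound; exists C => //; split=> // F _.
  have [p Fp] := CP F; exists (klein p); first by exists p.
  by apply: ball_sym; rewrite ballEmdist.
by exists F => //; exact: ballxx.
Qed.

End Cobounded.

(** * Local compactness *)

Section LocalCompactness.
Context {R : realType}.

Lemma rV_box_net n (r d : R) : 0 < r -> 0 < d ->
  exists (I : finType) (g : I -> 'rV[R]_n), forall a, rV_box r a ->
    exists i, rV_dot (a - g i) (a - g i) <= d.
Proof.
move=> r0 d0; pose h := Num.min 1 (d / n.+1%:R).
have h0 : 0 < h by rewrite lt_min ltr01 divr_gt0// ltr0n.
have h1 : h <= 1 by rewrite ge_min lexx.
pose N := (Num.truncn (2 * r / h)).+1.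
exists {ffun 'I_n -> 'I_N}, (fun k : {ffun 'I_n -> 'I_N} => \row_i (- r + (k i)%:R * h)) => a ba.
have /fin_all_exists[k kP] i : exists k : 'I_N, `|a 0 i - (- r + k%:R * h)| < h.
  have := ba i; rewrite ltr_norml => /andP[ra1 ra2].
  have q0 : 0 <= (a 0 i + r) / h by rewrite divr_ge0 ?ltW//; lra.
  have kN : (Num.truncn ((a 0 i + r) / h)%R < N)%N.
    by rewrite ltnS le_truncn// ler_pM2r ?invr_gt0//; lra.
  exists (Ordinal kN) => /=; have /andP[] := truncn_itv q0.
  rewrite ler_pdivlMr// ltr_pdivrMr// -natr1 => ? ?.
  by rewrite ltr_norml; apply/andP; split; lra.
exists [ffun i => k i]; apply: (@le_trans _ _ (n%:R * h)).
  by apply: rV_dot_box => // i; rewrite !mxE ffunE.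
apply: (@le_trans _ _ (n.+1%:R * h)); first by rewrite ler_pM2r// ler_nat.
by rewrite mulrC -ler_pdivlMr ?ltr0n// ge_min lexx orbT.
Qed.

(** Functions that agree up to e on a net of mesh d agree up to 2 * d + e, being
    1-Lipschitz. *)
Lemma acausal_near_of_net n (K e d : R) (F G : 'rV[R]_n -> R) (I : finType) (g : I -> 'rV[R]_n) :
  acausal_with K F -> acausal_with K G -> 0 <= d ->
  (forall a, rV_box (K + 2) a -> exists i, rV_dot (a - g i) (a - g i) <= d ^+ 2) ->
  (forall i, `|F (g i) - G (g i)| <= e) ->
  forall a, rV_box (K + 2) a -> `|F a - G a| <= 2 * d + e.
Proof.
move=> [_ lF _] [_ lG _] d0 net FG a /net[i ai].
have := FG i; have := sqr_le_normr d0 (le_trans (lF a (g i)) ai).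
have := sqr_le_normr d0 (le_trans (lG a (g i)) ai).
by rewrite !ler_norml => /andP[? ?] /andP[? ?] /andP[? ?]; apply/andP; split; lra.
Qed.

Context {m : nat}.
Local Notation M := (acausal R m.+1).

(** An ultrafilter of functions has a pointwise limit, which satisfies the same
    closed conditions.  Equicontinuity makes the convergence uniform on a box, and
    all separating sets lie over that box. *)
Lemma compact_acausal_with (K : R) : 0 <= K -> compact [set F : M | acausal_with K F].
Proof.
move=> K0; rewrite compact_ultra => U UU UK.
have UP : ProperFilter U by exact: ultra_proper.
have UF : Filter U by exact: filter_filter.
have lim a : exists l : R, (fun F : M => F a) @ U --> l.
  pose r := Num.sqrt (rV_dot a a).
  have UI : U [set F : M | `[- r, r]%classic (F a)].
    apply: filterS UK => F aF; rewrite /= in_itv /= -ler_norml.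
    apply: sqr_le_normr; rewrite ?sqrtr_ge0// sqr_sqrtr ?rV_dot_ge0//.
    exact: acausal_spacelike aF.
  have [l [_ lcl]] := @segment_compact R (- r) r ((fun F : M => F a) @ U) _ UI.
  (* along an ultrafilter a cluster point is a limit *)
  exists l => V Vl; case: (in_ultra_setVsetC ((fun F : M => F a) @^-1` V) UU) => // UV.
  by have [x [nVx Vx]] := lcl (~` V) V UV Vl.
have /choice[f fP] := lim.
have af : acausal_with K f.
  split=> [t a|a b|a].
  - apply: (@cvg_unique _ (@Rhausdorff R) _ _ _ _ (fP (t *: a))).
    have -> : (fun F : M => F (t *: a)) = (fun F : M => t * F a).
      by apply/funext => F; have [k _ [FZ _ _]] := acausalW F; rewrite FZ.
    by apply: cvgM; [exact: cvg_cst|exact: fP].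
  - have lim1 : (fun F : M => F a - F b) @ U --> f a - f b by apply: cvgB.
    have lim2 : (fun F : M => (F a - F b) * (F a - F b)) @ U --> (f a - f b) * (f a - f b).
      by apply: cvgM.
    rewrite expr2; apply: (closed_cvg (fun x : R => x <= rV_dot (a - b) (a - b))
      (@closed_le _ _) _ _ lim2).
    by apply: filterS UK => F [_ lF _]; have := lF a b; rewrite expr2.
  - have f2 : (fun F : M => F a * F a) @ U --> f a * f a by apply: cvgM.
    have : (1 + K) * (f a * f a) <= K * rV_dot a a.
      have lim2 : (fun F : M => (1 + K) * (F a * F a)) @ U --> (1 + K) * (f a * f a).
        by apply: cvgM => //; exact: cvg_cst.
      apply: (closed_cvg (fun x : R => x <= K * rV_dot a a) (@closed_le _ _) _ _ lim2).
      apply: filterS UK => F [_ _ FK]; have := FK a.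
      by rewrite expr2 /=; lra.
    by rewrite expr2; lra.
have fa : is_acausal f by apply/asboolP; exists K.
exists (Acausal fa); split=> //.
pose c := @crofton R m; have c0 : 0 < c := crofton_gt0.
pose B : R := 2 * (2 * (K + 2)) ^+ m.+1.
have B0 : 0 < B by rewrite mulr_gt0// exprn_gt0//; lra.
(* on this family volumes are at most B times the uniform distance over the box, which
   will be at most 3 * d *)
apply/cvg_ballP => e e0; pose d := e * c / (4 * B).
have d0 : 0 < d by apply: divr_gt0; apply: mulr_gt0 => //; exact: ltr0n.
have dE : B * (2 * d + d) < e * c.
  have -> : B * (2 * d + d) = 3 / 4 * (e * c) by rewrite /d; field; rewrite gt_eqF.
  by have : 0 < e * c by [exact: mulr_gt0]; move: (e * c) => x x0; clear -x0; lra.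
have [I [g net]] : exists (I : finType) (g : I -> 'rV[R]_m.+1), forall a, rV_box (K + 2) a ->
    exists i, rV_dot (a - g i) (a - g i) <= d ^+ 2.
  by apply: rV_box_net; [lra|exact: exprn_gt0].
have Ug : U [set F : M | forall i, `|f (g i) - F (g i)| <= d].
  by apply: filter_forall => i; move/cvgrPdist_le: (fP (g i)); apply.
apply: filterS2 UK Ug => F aF Fg; rewrite ballEmdist /=.
have -> : mdist (Acausal fa) F = volume_between f F / c by exact: acausal_mdistE.
rewrite ltr_pdivrMr//; apply: le_lt_trans dE.
have d20 : 0 <= 2 * d + d by clear -d0; lra.
have := volume_between_le K0 af aF d20
  (acausal_near_of_net af aF (ltW d0) net Fg).
by rewrite /B mulrAC.
Qed.

(** By homogeneity a slope bound may be checked on a sphere, and by oddness from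
    above only. *)
Lemma acausal_with_slope n (F : 'rV[R]_n -> R) k K : 0 <= k < 1 ->
  K = k ^+ 2 / (1 - k ^+ 2) -> (forall t a, F (t *: a) = t * F a) ->
  (forall a b, (F a - F b) ^+ 2 <= rV_dot (a - b) (a - b)) ->
  (forall a, rV_dot a a = 4^-1 -> F a <= k / 2) -> acausal_with K F.
Proof.
move=> /andP[k0 k1] KE FZ Fl Fk; split=> // a.
have F00 : F 0 = 0 by rewrite -(scale0r 0) FZ mul0r.
have k21 : 0 < 1 - k ^+ 2 by nra.
have slope b : F b ^+ 2 <= k ^+ 2 * rV_dot b b.
  have := rV_dot_ge0 b; rewrite le_eqVlt => /orP[/eqP b0|b0].
    by have := Fl b 0; rewrite !subr0 F00 subr0 -b0 mulr0.
  pose s := (2 * Num.sqrt (rV_dot b b))^-1.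
  have q0 : 0 < Num.sqrt (rV_dot b b) by rewrite sqrtr_gt0.
  have s0 : 0 < s by rewrite invr_gt0; lra.
  have q2 := sqr_sqrtr (ltW b0).
  have sb : rV_dot (s *: b) (s *: b) = 4^-1.
    rewrite rV_dotZl rV_dotZr mulrA -expr2 -[in X in _ * X]q2 /s.
    by field; rewrite gt_eqF.
  have h1 := Fk _ sb.
  have h2 : F (- (s *: b)) <= k / 2 by apply: Fk; rewrite rV_dotNl rV_dotNr opprK.
  rewrite -scaleNr FZ in h2; rewrite FZ in h1.
  have sq : s * Num.sqrt (rV_dot b b) = 2^-1 by rewrite /s; field; rewrite gt_eqF.
  have {}h1 : F b <= k * Num.sqrt (rV_dot b b).
    by rewrite -(ler_pM2l s0) mulrCA sq.
  have {}h2 : - F b <= k * Num.sqrt (rV_dot b b).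
    by rewrite -(ler_pM2l s0) mulrCA sq mulrN -mulNr.
  rewrite -[X in _ <= _ * X]q2 -exprMn -real_normK ?num_real//.
  rewrite ler_pXn2r ?nnegrE ?normr_ge0//; last by rewrite mulr_ge0// ltW.
  by rewrite ler_norml; apply/andP; split; lra.
have h := slope a; rewrite KE mulrAC ler_pdivlMr//; lra.
Qed.

(** If F has slope k0, a function G whose slope exceeds k = (1 + k0) / 2 somewhere has there a
    gap above F which costs at least the volume given by [volume_between_ge]. *)
Lemma acausal_ball_bounded (F : M) :
  exists K, exists2 e : R, 0 < e & 0 <= K /\ ball F e `<=` [set G : M | acausal_with K G].
Proof.
have [K0 K00 aF] := acausalW F; have [FZ Fl FK] := aF.
pose k0 := Num.sqrt (K0 / (1 + K0)); pose k := (1 + k0) / 2.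
have K01 : 0 <= K0 / (1 + K0) < 1.
  by rewrite divr_ge0 ?ltr_pdivrMr//=; lra.
have k02 : k0 ^+ 2 = K0 / (1 + K0) by rewrite sqr_sqrtr//; have /andP[] := K01.
have k00 : 0 <= k0 := sqrtr_ge0 _.
have k01 : k0 < 1 by have /andP[_ ?] := K01; nra.
have Fk0 a : rV_dot a a = 4^-1 -> F a <= k0 / 2.
  move=> a4; have := FK a; rewrite a4 => FaK.
  have : F a ^+ 2 <= (k0 / 2) ^+ 2.
    rewrite expr_div_n k02 mulrAC ler_pdivlMr; last lra.
    lra.
  have k020 : 0 <= k0 / 2 by apply: divr_ge0.
  by move=> /(sqr_le_normr k020); exact: le_trans (ler_norm _).
pose d := (1 - k0) / 16.
have d01 : 0 < d <= 4^-1 by rewrite /d; apply/andP; split; lra.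
pose c := @crofton R m; have c0 : 0 < c := crofton_gt0.
pose v : R := (2 * (d ^+ 2 / m.+2%:R)) ^+ m.+2.
have v0 : 0 < v.
  have /andP[? _] := d01.
  by rewrite exprn_gt0// mulr_gt0// divr_gt0 ?ltr0n ?exprn_gt0.
exists (k ^+ 2 / (1 - k ^+ 2)), (v / c); first exact: divr_gt0.
have k01' : 0 <= k < 1 by rewrite /k; apply/andP; split; lra.
split; first by have /andP[? ?] := k01'; rewrite divr_ge0 ?sqr_ge0//; nra.
move=> G; rewrite ballEmdist /=.
have -> : mdist F G = volume_between F G / c by exact: acausal_mdistE.
rewrite ltr_pM2r ?invr_gt0// => FG.
have [k' _ [GZ Gl _]] := acausalW G.
apply: (acausal_with_slope k01') => // a a4; rewrite leNgt; apply/negP => Ga.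
have := Fk0 a a4 => Fa.
move: FG; rewrite ltNge => /negP; apply.
apply: (volume_between_ge (acausalP F) (acausalP G) d01 (a := a)); first by rewrite a4.
by rewrite /d; rewrite /k in Ga; lra.
Qed.

Lemma acausal_locally_compact : locally_compact [set: M].
Proof.
move=> F _.
have [K [e e0 [K0 FK]]] := acausal_ball_bounded F.
have cK := compact_acausal_with K0.
exists [set G : M | acausal_with K G].
  by apply: (filterS _ (nbhsx_ballx F _ e0)) => G /FK.
split=> //; apply: compact_closed => //; exact: metric_hausdorff.
Qed.

End LocalCompactness.

(** * The locally compact median space *)

Theorem corollary1p3 (R : realType) (n : nat) (hn : (1 <= n)%N) :
  exists (M : metricType R)
         (act : isom (hyperbolic R n) -> M -> M)
         (phi : hyperbolic R n -> M),
    [/\ median_space M,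
        locally_compact [set: M],
        isometric_action act,
        isometric phi
      & (forall (g : isom (hyperbolic R n)) (x : hyperbolic R n),
           phi (g x) = act g (phi x))
        /\ (hausdorff_dist [set: M] (range phi) < +oo)%E].
Proof.
case: n hn => // m _.
exists (acausal R m.+1), acausal_act, klein; split.
- exact: acausal_median_space.
- exact: acausal_locally_compact.
- exact: acausal_act_isometric_action.
- exact: klein_isometric.
- by split; [exact: klein_equivariant|exact: hausdorff_klein].
Qed.
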